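(* Let $\Omega\subset\mathbb{R}^d$ be a bounded domain and let $f^+,f^-$ be finite positive Borel measures on $\Omega$. Suppose that $g_1,g_2:\partial\Omega\to\mathbb{R}$ satisfy $|g_1(x)-g_2(y)|\le|x-y|$ for all $(x,y)\in\partial\Omega\times\partial\Omega$, i.e. $g_1=g_2=:g$ and $g$ is $1$-Lipschitz. Consider the problem $$\text{(KPb)}\qquad \min\left\{\int_{\bar\Omega\times\bar\Omega}|x-y|\,d\gamma+\int_{\partial\Omega}g\,d(\Pi_y)_\#\gamma-\int_{\partial\Omega}g\,d(\Pi_x)_\#\gamma\ :\ \gamma\in\Pi b(f^+,f^-)\right\}.$$ Then there exists a minimizer $\gamma^\star$ of (KPb) such that $[x,y]\subset\bar\Omega$ for all $(x,y)\in\mathrm{spt}(\gamma^\star)$. In addition, if $g$ is $\lambda$-Lipschitz with $\lambda<1$, then for any minimizer $\gamma$ of (KPb) and all $(x,y)\in\mathrm{spt}(\gamma)$ one has $[x,y]\subset\bar\Omega$.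
   Context: $\Pi_x,\Pi_y:\bar\Omega\times\bar\Omega\to\bar\Omega$ are the projections onto the first and second factor, $\#$ denotes push-forward, and $\mathcal{M}^+(X)$ is the set of finite positive Borel measures on $X$. The set of admissible plans is $$\Pi b(f^+,f^-)=\{\gamma\in\mathcal{M}^+(\bar\Omega\times\bar\Omega): \big((\Pi_x)_\#\gamma\big)\llcorner\Omega=f^+,\ \big((\Pi_y)_\#\gamma\big)\llcorner\Omega=f^-\},$$ where $\llcorner\Omega$ denotes restriction to $\Omega$. $[x,y]$ is the closed segment from $x$ to $y$ and $\mathrm{spt}$ denotes the support of a measure. $\Omega$ is not assumed convex. Lipschitz constants are with respect to the Euclidean distance. *)

(* Defs.v *)
From HB Require Import structures.
From mathcomp Require Import all_boot all_order all_algebra.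
From mathcomp Require Import all_classical all_reals all_analysis.
Import numFieldNormedType.Exports.

Set Implicit Arguments.
Unset Strict Implicit.
Unset Printing Implicit Defensive.

Import Order.TTheory GRing.Theory Num.Theory.
Local Open Scope classical_set_scope.
Local Open Scope ring_scope.

(* T with the sigma-algebra generated by its open sets. *)
Notation borel T := (g_sigma_algebraType (open : set (set T%type))).

(* The library norm on 'rV[R]_d is the sup norm; it induces the same topology
   and the same bounded sets, but lengths and Lipschitz constants below are
   Euclidean. *)
Definition eucl_norm (R : realType) (d : nat) (v : 'rV[R]_d) : R :=
  Num.sqrt (\sum_(i < d) v 0 i ^+ 2).

Definition eucl_dist (R : realType) (d : nat) (x y : 'rV[R]_d) : R :=
  eucl_norm (x - y).

Definition boundary (T : topologicalType) (A : set T) : set T :=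
  closure A `\` interior A.

Definition eucl_lipschitz_on (R : realType) (d : nat) (A : set 'rV[R]_d) (k : R)
    (g : 'rV[R]_d -> R) : Prop :=
  forall x y, A x -> A y -> `|g x - g y| <= k * eucl_dist x y.

Definition closed_segment (R : realType) (d : nat) (x y : 'rV[R]_d) :
    set 'rV[R]_d :=
  [set (1 - t) *: x + t *: y | t in `[0, 1]].

Definition spt (R : realType) (T : topologicalType) (mu : set T -> \bar R) :
    set T :=
  [set z | forall U : set T, open U -> U z -> (0 < mu U)%E].

(* The finite positive Borel measures on a Borel set X of a space T are encoded
   as the finite Borel measures on T that vanish on the complement of X. *)
Definition concentrated_on (R : realType) (T : Type) (X : set T)
    (mu : set T -> \bar R) : Prop :=
  mu (~` X) = 0%E.

Section KPb.
Variables (R : realType) (d : nat).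
Local Notation V := 'rV[R]_d.
Local Notation VV := (V * V)%type.

Definition marginal_x (gamma : set (borel VV) -> \bar R) :
    set (borel V) -> \bar R :=
  pushforward gamma (fst : borel VV -> borel V).

Definition marginal_y (gamma : set (borel VV) -> \bar R) :
    set (borel V) -> \bar R :=
  pushforward gamma (snd : borel VV -> borel V).

(* Restriction of a measure is spelled out: (mu |_ Omega) A = mu (A & Omega). *)
Definition admissible (Omega : set V) (fp fm : set (borel V) -> \bar R)
    (gamma : {finite_measure set (borel VV) -> \bar R}) : Prop :=
  [/\ concentrated_on (closure Omega `*` closure Omega) gamma,
      forall A : set (borel V), measurable A ->
        marginal_x gamma (A `&` Omega) = fp A
    & forall A : set (borel V), measurable A ->
        marginal_y gamma (A `&` Omega) = fm A].

Definition KPb_cost (Omega : set V) (g : V -> R)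
    (gamma : {finite_measure set (borel VV) -> \bar R}) : \bar R :=
  (\int[gamma]_(z in (closure Omega `*` closure Omega : set (borel VV)))
      (eucl_dist z.1 z.2)%:E
   + \int[marginal_y gamma]_(y in (boundary Omega : set (borel V))) (g y)%:E
   - \int[marginal_x gamma]_(x in (boundary Omega : set (borel V))) (g x)%:E)%E.

Definition KPb_minimizer (Omega : set V) (fp fm : set (borel V) -> \bar R)
    (g : V -> R) (gamma : {finite_measure set (borel VV) -> \bar R}) : Prop :=
  admissible Omega fp fm gamma /\
  forall gamma' : {finite_measure set (borel VV) -> \bar R},
    admissible Omega fp fm gamma' ->
    (KPb_cost Omega g gamma <= KPb_cost Omega g gamma')%E.

End KPb.

(* Main.v *)
Require Import Defs.
From HB Require Import structures.
From mathcomp Require Import all_boot all_order all_algebra.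
From mathcomp Require Import all_classical all_reals all_analysis.
From mathcomp Require Import measurable_realfun ring lra.
Import numFieldNormedType.Exports.

Set Implicit Arguments.
Unset Strict Implicit.
Unset Printing Implicit Defensive.

Import Order.TTheory GRing.Theory Num.Theory.
Local Open Scope classical_set_scope.
Local Open Scope ring_scope.

(** The 1-Lipschitz datum g extends to a 1-Lipschitz function h on the whole
    space. On admissible plans the objective is, up to a constant, the integral
    of the nonnegative continuous cost c(x,y) = |x-y| + h(y) - h(x), so mass on
    the product of the boundary with itself can be discarded and minimizing
    sequences have bounded mass. An ultrafilter limit of such a sequence is a
    content on compact sets, hence yields a Borel measure satisfying the
    portmanteau inequalities; this gives minimizers of every nonnegative
    continuous cost.

    If (x,y) is in the support of a minimizer and [x,y] leaves the closed
    domain, let p and q be its first exit and last entry points. Near (x,y) the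
    mass may be sent to the fixed point p and taken from the fixed point q, so
    minimality forces c(x,y) <= c(x,p) + c(q,y). This contradicts
    |h(p)-h(q)| <= lambda |p-q| when lambda < 1. When g is merely 1-Lipschitz,
    the same contradiction holds for the costs c + |x-y|/n, and a limit of their
    minimizers minimizes c and keeps the (closed) support property. *)

(* The library equips products with a point and with a topology, but not with
   their join. A global instance would change the topology inferred in the
   statement of the theorem to a convertible but different term. *)
Module PairTopology.
HB.instance Definition _ (T U : ptopologicalType) :=
  Topological.on (T * U)%type.
End PairTopology.

(** * Borel measure induced by a content on compact sets *)

Section compact_content.
Context (R : realType) (T : ptopologicalType).
Hypotheses (hT : hausdorff_space T) (nT : normal_space T).
Variables (l : set T -> R) (M : R).
Hypothesis l_ge0 : forall C, compact C -> 0 <= l C.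
Hypothesis l_leM : forall C, compact C -> l C <= M.
Hypothesis lU_le : forall C D, compact C -> compact D ->
  l (C `|` D) <= l C + l D.
Hypothesis lU_ge : forall C D, compact C -> compact D -> C `&` D = set0 ->
  l C + l D <= l (C `|` D).

Local Open Scope ereal_scope.

(** The classical passage from a content to a measure: [inner_content] is meant for open sets, and
    [outer_content] extends it to all sets by approximation from outside. *)
Definition inner_content (U : set T) : \bar R :=
  ereal_sup [set (l C)%:E | C in [set C | compact C /\ C `<=` U]].

Definition outer_content (A : set T) : \bar R :=
  ereal_inf [set inner_content U | U in [set U | open U /\ A `<=` U]].

Local Notation inner := inner_content.
Local Notation outer := outer_content.

Lemma content0 : l set0 = 0%R.
Proof.
have := lU_ge (@compact0 T) (@compact0 T) (setI0 _).
rewrite setU0 -subr_ge0 opprD addrA subrr add0r oppr_ge0 => l0.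
by apply/eqP; rewrite eq_le l0 l_ge0//; exact: compact0.
Qed.

Implicit Types C D U V : set T.

Lemma inner_content_ge C U : compact C -> C `<=` U -> (l C)%:E <= inner U.
Proof. by move=> cC CU; apply: ereal_sup_ubound; exists C. Qed.

Lemma inner_content_ge0 U : 0 <= inner U.
Proof.
by rewrite -[0]/(0%:E) -content0; apply: inner_content_ge => //; exact: compact0.
Qed.

Lemma inner_content_le U : inner U <= M%:E.
Proof. by apply/ereal_supP => _ [C [cC _] <-]; rewrite lee_fin l_leM. Qed.

Lemma le_inner_content U V : U `<=` V -> inner U <= inner V.
Proof.
move=> UV; apply/ereal_supP => _ [C [cC CU] <-].
by apply: inner_content_ge => //; exact: subset_trans UV.
Qed.

Lemma inner_content_fin U : inner U \is a fin_num.
Proof.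
by rewrite ge0_fin_numE ?inner_content_ge0// (le_lt_trans (inner_content_le U))// ltry.
Qed.

(** The closed set [C \ V] lies in [U], so normality gives open [W'] with [C \ V] inside [W'], [W']
    inside [W] and the closure of [W] inside [U]. Cutting [C] along this collar yields the two
    pieces and hence subadditivity on open sets. *)
Lemma compact_split C U V : open U -> open V -> compact C -> C `<=` U `|` V ->
  exists C1 C2, [/\ compact C1, compact C2, C1 `<=` U, C2 `<=` V & C = C1 `|` C2].
Proof.
move=> oU oV cC CUV.
have clC : closed C by exact: compact_closed.
have clD : closed (C `\` V) by apply: closedI => //; exact: open_closedC.
have [W /set_nbhsP[W' [oW' CW' W'W]] WU] : filter_from (set_nbhs (C `\` V)) closure U.
  apply: nT => //; apply/set_nbhsP; exists U; split => //.
  by move=> x [Cx Vx]; case: (CUV x Cx).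
exists (C `&` closure W), (C `\` W'); split.
- by apply: compact_closedI => //; exact: closed_closure.
- by apply: compact_closedI => //; exact: open_closedC.
- by move=> x [_ /WU].
- move=> x [Cx W'x]; apply: contrapT => Vx; apply: W'x; exact: CW'.
- rewrite predeqE => x; split => [Cx|[] []//].
  have [W'x|W'x] := pselect (W' x); last by right.
  by left; split => //; apply/subset_closure/W'W.
Qed.

Lemma inner_contentU U V : open U -> open V ->
  inner (U `|` V) <= inner U + inner V.
Proof.
move=> oU oV; apply/ereal_supP => _ [C [cC CUV] <-].
have [C1 [C2 [cC1 cC2 C1U C2V ->]]] := compact_split oU oV cC CUV.
apply: (@le_trans _ _ (l C1 + l C2)%:E); first by rewrite lee_fin lU_le.
by rewrite EFinD; apply: leeD; exact: inner_content_ge.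
Qed.

Lemma inner_content_bigsetU (F : (set T)^nat) n : (forall i, open (F i)) ->
  inner (\big[setU/set0]_(i < n) F i) <= \sum_(i < n) inner (F i).
Proof.
move=> oF; elim: n => [|n ih].
  rewrite !big_ord0; apply/ereal_supP => _ [C [_ C0] <-].
  by move: C0; rewrite subset0 => ->; rewrite content0.
rewrite !big_ord_recr/=; apply: (le_trans (inner_contentU _ _)) => //.
  by rewrite -bigcup_mkord; exact: bigcup_open.
exact: leeD.
Qed.

Lemma inner_content_bigcup (F : (set T)^nat) : (forall i, open (F i)) ->
  inner (\bigcup_i F i) <= \sum_(i <oo) inner (F i).
Proof.
move=> oF; apply/ereal_supP => _ [C [cC CF] <-].
have [n Cn] : exists n, C `<=` \big[setU/set0]_(i < n) F i.
  move: cC; rewrite compact_cover => /(_ _ setT F (fun i _ => oF i) CF)[D _ CD].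
  (* The finite subcover is enlarged to an initial segment of the sequence, past its largest
     index. *)
  exists (\max_(i <- finmap.enum_fset D) i).+1 => x /CD[i /= iD Fix].
  rewrite -bigcup_mkord; exists i => //=; rewrite ltnS.
  exact: (@leq_bigmax_seq _ _ xpredT id).
apply: (le_trans (inner_content_ge cC Cn)).
apply: (le_trans (inner_content_bigsetU _ oF)).
rewrite -(big_mkord xpredT (inner \o F)).
by apply: nneseries_lim_ge => i _ _; exact: inner_content_ge0.
Qed.

Lemma outer_content_open U : open U -> outer U = inner U.
Proof.
move=> oU; apply/eqP; rewrite eq_le; apply/andP; split.
  by apply: ereal_inf_lbound; exists U => //; split.
by apply/ereal_infP => _ [V [_ UV] <-]; exact: le_inner_content.
Qed.

Lemma le_outer_content : {homo outer : A B / A `<=` B >-> A <= B}.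
Proof.
move=> A B AB; apply/ereal_infP => _ [V [oV BV] <-].
by apply: ereal_inf_lbound; exists V => //; split => //; exact: subset_trans BV.
Qed.

Lemma outer_content_ge0 A : 0 <= outer A.
Proof. by apply/ereal_infP => _ [V _ <-]; exact: inner_content_ge0. Qed.

Lemma outer_content_le A : outer A <= M%:E.
Proof.
apply: le_trans (inner_content_le setT).
by apply: ereal_inf_lbound; exists setT => //; split => //; exact: openT.
Qed.

Lemma outer_content_fin A : outer A \is a fin_num.
Proof.
by rewrite ge0_fin_numE ?outer_content_ge0// (le_lt_trans (outer_content_le A))// ltry.
Qed.

Lemma outer_content0 : outer set0 = 0.
Proof.
rewrite outer_content_open; last exact: open0.
apply/eqP; rewrite eq_le inner_content_ge0 andbT.
apply/ereal_supP => _ [C [_ C0] <-].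
by move: C0; rewrite subset0 => ->; rewrite content0.
Qed.

Lemma outer_content_approx A (e : R) : (0 < e)%R ->
  exists U, [/\ open U, A `<=` U & inner U <= outer A + e%:E].
Proof.
move=> e0; have [_ [U [oU AU] <-] /ltW] := lb_ereal_inf_adherent e0 (outer_content_fin A).
by exists U.
Qed.

Lemma inner_content_approx U (e : R) : (0 < e)%R ->
  exists C, [/\ compact C, C `<=` U & inner U <= (l C)%:E + e%:E].
Proof.
move=> e0; have [_ [C [cC CU] <-] /ltW] := ub_ereal_sup_adherent e0 (inner_content_fin U).
by exists C; split => //; rewrite -leeBlDr.
Qed.

Lemma outer_content_sigma_subadditive : sigma_subadditive outer.
Proof.
move=> F; apply/lee_addgt0Pr => e e0.
apply: (le_trans _ (epsilon_trick _ (fun n => outer_content_ge0 (F n)) (ltW e0))).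
have /choice[G PG] n : exists U, [/\ open U, F n `<=` U &
    inner U <= outer (F n) + (e / (2 ^ n.+1)%:R)%:E].
  by apply: outer_content_approx; rewrite divr_gt0// ltr0n expn_gt0.
apply: (@le_trans _ _ (inner (\bigcup_n G n))).
  apply: ereal_inf_lbound; exists (\bigcup_n G n) => //; split.
    by apply: bigcup_open => n _; have [] := PG n.
  by apply: subset_bigcup => n _; have [] := PG n.
apply: (le_trans (inner_content_bigcup _)); first by move=> n; have [] := PG n.
apply: lee_nneseries => [n _ _|n _]; first exact: inner_content_ge0.
by have [] := PG n.
Qed.

HB.instance Definition _ := isOuterMeasure.Build R T outer
  outer_content0 outer_content_ge0 le_outer_content
  outer_content_sigma_subadditive.

(** An open [V] nearly optimal for [A] is split by two disjoint compact sets, on which [l] is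
    superadditive. There are three approximations, each costing [e / 3]. *)
Lemma caratheodory_outer_content U : open U -> outer.-caratheodory U.
Proof.
move=> oU; apply: le_caratheodory_measurable => A.
apply/lee_addgt0Pr => e e0.
have e3 : (0 < e / 3)%R by rewrite divr_gt0.
have [V [oV AV Vle]] := outer_content_approx A e3.
have [C [cC CVU Cle]] := inner_content_approx (V `&` U) e3.
have clC : closed C by exact: compact_closed.
(* [D] is taken inside [V \ C] and not [V \ U]: the former is open, still contains [A \ U], and
   makes [D] disjoint from [C]. *)
have [D [cD DVC Dle]] := inner_content_approx (V `\` C) e3.
have AU : outer (A `&` U) <= (l C)%:E + (e / 3)%:E.
  apply: le_trans Cle; apply: ereal_inf_lbound; exists (V `&` U) => //.
  by split; [exact: openI|exact: setSI].
have AnU : outer (A `&` ~` U) <= (l D)%:E + (e / 3)%:E.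
  apply: le_trans Dle; apply: ereal_inf_lbound; exists (V `\` C) => //.
  split; first by apply: openI => //; exact: closed_openC.
  by move=> x [/AV Vx nUx]; split => // /CVU[].
apply: (le_trans (leeD AU AnU)).
have CD : (l C + l D)%:E <= outer A + (e / 3)%:E.
  apply: le_trans Vle; apply: (@le_trans _ _ (l (C `|` D))%:E).
    rewrite lee_fin lU_ge//; apply/disjoints_subset => x Cx Dx.
    by have [] := DVC x Dx.
  apply: inner_content_ge; first exact: compactU.
  by move=> x [/CVU[]//|/DVC[]].
rewrite addeACA; apply: (le_trans (leeD CD (lexx _))).
by rewrite -addeA -!EFinD leeD2l// lee_fin; lra.
Qed.

(** Open sets are Caratheodory measurable, hence so are all Borel sets, and the outer measure is
    sigma-additive on them. The bound on a compact [C] holds because every open set containing [C]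
    has inner content at least [l C]. *)
Lemma content_measure : exists mu : {finite_measure set (borel T) -> \bar R},
  [/\ mu setT <= M%:E,
      forall U, open U -> mu U = inner_content U &
      forall C, compact C -> (l C)%:E <= mu C].
Proof.
have sub : (measurable : set (set (borel T))) `<=`
    (measurable : set (set (caratheodory_type outer))).
  apply: smallest_sub; first exact: sigma_algebra_measurable.
  exact: caratheodory_outer_content.
have sa : semi_sigma_additive (outer : set (borel T) -> \bar R).
  move=> F mF tF mUF; apply: caratheodory_measure_sigma_additive => //.
    by move=> i; exact: sub.
  exact: sub.
pose m0 := isMeasure.Build _ (borel T) R outer outer_content0 outer_content_ge0 sa.
pose m : {measure set (borel T) -> \bar R} := HB.pack (outer : set (borel T) -> \bar R) m0.
have fm : fin_num_fun m by move=> A _; exact: outer_content_fin.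
pose f0 := @Measure_isFinite.Build _ (borel T) R m fm.
pose mu : {finite_measure set (borel T) -> \bar R} :=
  HB.pack (outer : set (borel T) -> \bar R) m0 f0.
exists mu; split.
- exact: outer_content_le.
- exact: outer_content_open.
- move=> C cC; apply/ereal_infP => _ [V [_ CV] <-]; exact: inner_content_ge.
Qed.

End compact_content.

(** * Compactness of finite measures *)

Lemma open_borel (T : ptopologicalType) (U : set T) :
  open U -> measurable (U : set (borel T)).
Proof. by move=> oU; exact: sub_sigma_algebra. Qed.

Lemma closed_borel (T : ptopologicalType) (C : set T) :
  closed C -> measurable (C : set (borel T)).
Proof.
by move=> cC; have := measurableC (open_borel (closed_openC cC)); rewrite setCK.
Qed.

Lemma ultra_fmap (S T : Type) (f : S -> T) (F : set_system S) :
  UltraFilter F -> UltraFilter (f @ F).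
Proof.
move=> UF; split => [|G PG FG]; first exact: fmap_proper_filter.
rewrite predeqE => A; split=> [GA|/FG//].
have [//|FA] := in_ultra_setVsetC (f @^-1` A) UF.
have /filter_ex[x []] // : G (A `&` ~` A) by apply: filterI => //; exact: FG.
Qed.

Lemma ultra_lim_bounded (R : realType) (F : set_system nat) (u : nat -> R) (M : R) :
  UltraFilter F -> (forall n, 0 <= u n <= M) -> exists a : R, u n @[n --> F] --> a.
Proof.
move=> UF uM; have := @segment_compact R 0 M.
rewrite compact_ultra => /(_ (u @ F) _)[||a [_ ua]]; last by exists a.
- exact: ultra_fmap.
- by change (F (u @^-1` `[0, M])); apply: filterE => n /=; rewrite in_itv/=.
Qed.

(** Along an ultrafilter finer than [\oo] the bounded sequences [gamma n A] converge for all Borel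
    [A] at once, with no extraction of subsequences. The limit [l] inherits finite additivity, and
    [mu] is built from its values on compact sets. The last two clauses are the portmanteau
    inequalities. *)
Lemma finite_measures_compact (R : realType) (T : ptopologicalType)
    (hT : hausdorff_space T) (nT : normal_space T) (M : R)
    (gamma : nat -> {finite_measure set (borel T) -> \bar R}) :
  (forall n, gamma n setT <= M%:E)%E ->
  exists (F : set_system nat) (l : set (borel T) -> R)
    (mu : {finite_measure set (borel T) -> \bar R}),
  [/\ ProperFilter F /\ \oo `<=` F,
      forall A, measurable A -> fine (gamma n A) @[n --> F] --> l A,
      (mu setT <= M%:E)%E,
      forall U : set T, open U -> (mu U <= (l U)%:E)%E &
      forall C : set T, compact C -> ((l C)%:E <= mu C)%E].
Proof.
move=> gM; have [F [UF ooF]] := @ultraFilterLemma _ (\oo : set_system nat) _.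
have gE n A : measurable A -> gamma n A = (fine (gamma n A))%:E.
  by move=> mA; rewrite fineK// fin_num_measure.
have gle n A : measurable A -> 0 <= fine (gamma n A) <= M.
  move=> mA; rewrite fine_ge0//= -lee_fin -gE//; apply: le_trans (gM n).
  by apply: le_measure; rewrite ?inE.
have /choice[l lP] (A : set (borel T)) : exists a : R,
    measurable A -> fine (gamma n A) @[n --> F] --> a.
  (* Non-measurable sets get the default value 0. *)
  have [mA|] := pselect (measurable A); last by exists 0.
  have [a ua] := @ultra_lim_bounded _ F (fun n => fine (gamma n A)) M UF (fun n => gle n A mA).
  by exists a.
have mcpt (C : set T) : compact C -> measurable (C : set (borel T)).
  by move=> cC; apply: closed_borel; exact: compact_closed.
have PF : ProperFilter F by exact: ultra_proper.
have le_l (A B : set (borel T)) : measurable A -> measurable B -> A `<=` B -> l A <= l B.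
  move=> mA mB AB; apply: (ler_cvg_to (lP A mA) (lP B mB)).
  apply: filterE => n; rewrite -lee_fin -!gE//.
  by apply: le_measure; rewrite ?inE.
have l_itv (A : set (borel T)) : measurable A -> 0 <= l A <= M.
  move=> mA; apply/andP; split.
    by apply: (cvgr_to_ge (lP A mA)); apply: filterE => n; have /andP[] := gle n A mA.
  by apply: (cvgr_to_le (lP A mA)); apply: filterE => n; have /andP[] := gle n A mA.
have lU_le (A B : set (borel T)) : measurable A -> measurable B ->
    l (A `|` B) <= l A + l B.
  move=> mA mB; have mAB := measurableU _ _ mA mB.
  apply: (ler_cvg_to (lP _ mAB) (cvgD (lP A mA) (lP B mB))).
  apply: filterE => n; rewrite -lee_fin EFinD -!gE//; exact: measureU2.
have lU_ge (A B : set (borel T)) : measurable A -> measurable B -> A `&` B = set0 ->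
    l A + l B <= l (A `|` B).
  move=> mA mB AB0; have mAB := measurableU _ _ mA mB.
  apply: (ler_cvg_to (cvgD (lP A mA) (lP B mB)) (lP _ mAB)).
  by apply: filterE => n; rewrite -lee_fin EFinD -!gE// measureU.
have [] := @content_measure R T hT nT l M.
- by move=> C /mcpt /l_itv/andP[].
- by move=> C /mcpt /l_itv/andP[].
- by move=> C D /mcpt mC /mcpt mD; exact: lU_le.
- by move=> C D /mcpt mC /mcpt mD; exact: lU_ge.
move=> mu [muM muU muC]; exists F, l, mu; split => //.
move=> U oU; rewrite muU//; apply/ereal_supP => _ [C [cC CU] <-].
by rewrite lee_fin; apply: le_l => //; [exact: mcpt|exact: open_borel].
Qed.

(** * Lower semicontinuity of integrals *)

Lemma continuous_borel_measurable (R : realType) (T : ptopologicalType)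
    (D : set (borel T)) (phi : T -> R) :
  measurable D -> continuous phi -> measurable_fun D (phi : borel T -> R).
Proof.
move=> mD cphi; apply: (measurability _ (measurable_realfun.RGenOInfty.measurableE R)).
move=> _ [_ [a ->] <-]; apply: measurableI => //; apply: open_borel.
by move/continuousP : cphi; apply; exact: interval_open.
Qed.

Lemma continuous_map_borel_measurable (S T : ptopologicalType)
    (D : set (borel S)) (f : S -> T) :
  measurable D -> continuous f -> measurable_fun D (f : borel S -> borel T).
Proof.
move=> mD cf; apply: (@measurability _ _ (borel S) (borel T) D f (open : set (set T)) erefl).
move=> _ [U oU <-]; apply: measurableI => //; apply: open_borel.
by move/continuousP : cf; apply.
Qed.

Lemma measureI_conc (disp : measure_display) (T : measurableType disp)
    (R : realType) (mu : {measure set T -> \bar R}) (A D : set T) :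
  measurable A -> measurable D -> mu (~` D) = 0%E -> mu (A `&` D) = mu A.
Proof.
move=> mA mD D0; rewrite [RHS](measureDI _ mA mD).
rewrite [X in (X + _)%E](_ : _ = 0%E) ?add0e//.
apply: (@subset_measure0 _ _ _ _ _ (~` D)) => //; first exact: measurableD.
exact: measurableC.
Qed.

Section staircase.
Context (R : realType).
Implicit Types (d u : R).

(** For [d > 0] and [u >= 0] this rounds [u] up to a multiple of [d], capped at [N * d]. Composed
    with a continuous function it is a positive combination of indicators of open sets. *)
Definition staircase d (N : nat) u : R := \sum_(k < N) (if k%:R * d < u then d else 0).

Lemma staircase_ge d N u : 0 <= d -> u <= N%:R * d -> u <= staircase d N u.
Proof.
(* The disjunction is the inductive invariant: either the staircase has caught up with [u], or every
   step so far has been climbed. *)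
move=> d0 uN; suff: u <= staircase d N u \/ N%:R * d <= staircase d N u.
  by case=> //; exact: le_trans.
rewrite /staircase; elim: N {uN} => [|N ih].
  by right; rewrite big_ord0 mul0r.
rewrite big_ord_recr/= -natr1 mulrDl mul1r.
by case: ltP => h; case: ih => ih; [left|right|left|left]; lra.
Qed.

Lemma staircase_le d N u : 0 <= d -> 0 <= u -> staircase d N u <= u + d.
Proof.
(* The second bound carries the induction: a further step is climbed only when [N * d < u]. *)
move=> d0 u0; suff: staircase d N u <= u + d /\ staircase d N u <= N%:R * d by case.
rewrite /staircase; elim: N => [|N [ih1 ih2]].
  by rewrite big_ord0 mul0r addr_ge0.
rewrite big_ord_recr/= -natr1 mulrDl mul1r.
by case: ltP => h; split; lra.
Qed.

End staircase.

Lemma open_superlevel (R : realType) (T : topologicalType) (phi : T -> R) (a : R) :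
  continuous phi -> open [set z | a < phi z].
Proof.
move=> cphi; rewrite [X in open X](_ : _ = phi @^-1` `]a, +oo[).
  by move/continuousP : cphi; apply; exact: interval_open.
by apply/seteqP; split => z /=; rewrite in_itv/= andbT.
Qed.

Section staircase_integral.
Context (R : realType) (T : ptopologicalType) (phi : T -> R).
Hypothesis cphi : continuous phi.
Local Open Scope ereal_scope.

Lemma integral_staircase (mu : {measure set (borel T) -> \bar R})
    (D : set (borel T)) d N : measurable D -> (0 <= d)%R ->
  \int[mu]_(z in D) (staircase d N (phi z))%:E =
  \sum_(k < N) d%:E * mu ([set z | (k%:R * d < phi z)%R] `&` D).
Proof.
move=> mD d0.
have mU k : measurable ([set z | (k%:R * d < phi z)%R] : set (borel T)).
  by apply: open_borel; exact: open_superlevel.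
transitivity (\sum_(k < N) \int[mu]_(z in D)
   (d%:E * (\1_[set z | ((k : nat)%:R * d < phi z)%R] z)%:E)).
  rewrite -ge0_integral_sum//.
  - apply: eq_integral => z _; rewrite /staircase -sumEFin; apply: eq_bigr => k _.
    rewrite indicE; case: ifPn => h; first by rewrite mem_set// mule1.
    by rewrite memNset ?mule0//; exact/negP.
  - move=> k; apply: measurable_funeM; apply/measurable_EFinP.
    by apply: measurable_funTS; exact: measurable_indic.
  - by move=> k z _; rewrite mule_ge0.
apply: eq_bigr => k _; rewrite ge0_integralZl_EFin//.
  by rewrite integral_indic.
apply/measurable_EFinP; apply: measurable_funTS; exact: measurable_indic.
Qed.

End staircase_integral.

(** On [D] the staircase exceeds [phi] by at most [d]. Its integral is a finite sum of measures of
    open sets, for which [mu] is bounded by the limit [l]; the rounding costs at most [d * M] under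
    every [gamma n]. *)
Lemma integral_lsc (R : realType) (T : ptopologicalType) (M B a : R)
    (gamma : nat -> {finite_measure set (borel T) -> \bar R})
    (mu : {finite_measure set (borel T) -> \bar R})
    (F : set_system nat) (l : set (borel T) -> R) (D : set (borel T)) (phi : T -> R) :
  ProperFilter F ->
  (forall A, measurable A -> fine (gamma n A) @[n --> F] --> l A) ->
  (forall n, gamma n setT <= M%:E)%E ->
  (forall U : set T, open U -> (mu U <= (l U)%:E)%E) ->
  measurable D -> (forall n, gamma n (~` D) = 0)%E ->
  continuous phi -> (forall z, 0 <= phi z) -> (forall z, D z -> phi z <= B) ->
  (\forall n \near F, \int[gamma n]_(z in D) (phi z)%:E <= a%:E)%E ->
  (\int[mu]_(z in D) (phi z)%:E <= a%:E)%E.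
Proof.
move=> FF gl gM mul mD gD cphi phi0 phiB ga.
have M0 : 0 <= M by rewrite -lee_fin; apply: le_trans (gM 0); exact: measure_ge0.
apply/lee_addgt0Pr => e e0.
have M1 : 0 < M + 1 by rewrite ltr_wpDl.
have [d d0 dM] : exists2 d : R, 0 < d & d * M <= e.
  (* Dividing by [M + 1] covers the case [M = 0]. *)
  exists (e / (M + 1)); first by rewrite divr_gt0.
  by rewrite mulrAC ler_pdivrMr// ler_pM2l// lerDl.
(* Enough steps for the cap of the staircase to lie above [phi] on [D]. *)
have [N BN] : exists N : nat, B <= N%:R * d.
  exists (Num.trunc (B / d)).+1; rewrite -ler_pdivrMr//.
  by apply: ltW; rewrite truncnS_gt.
pose U (k : nat) := [set z | k%:R * d < phi z].
have oU k : open (U k) by exact: open_superlevel.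
have mU k : measurable (U k : set (borel T)) by exact: open_borel.
have mphi : measurable_fun D (EFin \o phi).
  by apply/measurable_EFinP; exact: continuous_borel_measurable.
have mst : measurable_fun D (fun z => (staircase d N (phi z))%:E).
  apply/measurable_EFinP; rewrite /staircase; apply: measurable_sum => k.
  rewrite [X in measurable_fun _ X](_ : _ = (fun z => d * \1_(U k) z)).
    by apply: measurable_funM => //; apply: measurable_funTS; exact: measurable_indic.
  apply/funext => z; rewrite indicE; case: ifPn => h; first by rewrite mem_set// mulr1.
  by rewrite memNset ?mulr0//; exact/negP.
have st0 z : 0 <= staircase d N (phi z).
  by rewrite /staircase sumr_ge0// => k _; case: ifP => // _; exact: ltW.
have gE n (A : set (borel T)) : measurable A -> gamma n A = (fine (gamma n A))%:E.
  by move=> mA; rewrite fineK// fin_num_measure.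
have gU n k : gamma n (U k `&` D) = gamma n (U k).
  exact: (measureI_conc (mU k) mD (gD n)).
apply: (@le_trans _ _ (\sum_(k < N) d * l (U k))%:E).
  apply: (@le_trans _ _ (\int[mu]_(z in D) (staircase d N (phi z))%:E)%E).
    apply: ge0_le_integral => //.
    - by move=> z _; rewrite lee_fin.
    - move=> z Dz; rewrite lee_fin; apply: staircase_ge; first exact: ltW.
      exact: le_trans (phiB _ Dz) BN.
  rewrite integral_staircase//; last exact: ltW.
  rewrite -sumEFin; apply: lee_sum => k _.
  rewrite EFinM; apply: lee_wpmul2l; first by rewrite lee_fin ltW.
  apply: le_trans (mul _ (oU k)).
  by apply: measureIl => //; exact: mU.
rewrite -EFinD lee_fin.
have lim m : \sum_(k < m) d * fine (gamma n (U k)) @[n --> F] --> \sum_(k < m) d * l (U k).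
  elim: m => [|m ih].
    by rewrite big_ord0; under eq_fun do rewrite big_ord0; exact: cvg_cst.
  rewrite big_ord_recr/=; under eq_fun do rewrite big_ord_recr/=.
  by apply: cvgD ih _; apply: cvgMl_tmp; exact: gl.
apply: (cvgr_to_le (lim N)); near=> n.
rewrite -lee_fin -sumEFin.
apply: (@le_trans _ _ (\int[gamma n]_(z in D) (staircase d N (phi z))%:E)%E).
  rewrite integral_staircase//; last exact: ltW.
  by apply: lee_sum => k _; rewrite EFinM -gE// -(gU n k).
apply: (@le_trans _ _ (\int[gamma n]_(z in D) ((phi z)%:E + (cst d%:E) z))%E).
  apply: ge0_le_integral => //.
  - by move=> z _; rewrite lee_fin.
  - by apply: emeasurable_funD.
  - by move=> z _; rewrite /cst -EFinD lee_fin; apply: staircase_le => //; exact: ltW.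
rewrite ge0_integralD//; last 2 first.
  - by move=> z _; rewrite lee_fin.
  - by move=> z _; rewrite /cst lee_fin ltW.
rewrite integral_cst// EFinD; apply: leeD; first by near: n.
apply: (@le_trans _ _ (d%:E * M%:E)%E); last by rewrite -EFinM lee_fin.
apply: lee_wpmul2l; first by rewrite lee_fin ltW.
apply: le_trans (gM n).
by apply: le_measure; rewrite ?inE.
Unshelve. all: by end_near. Qed.

(** * Euclidean geometry of a domain *)

Section euclidean.
Context (R : realType) (d : nat).
Implicit Types (u v x y z : 'rV[R]_d) (k : R).

Lemma eucl_norm_sq v : eucl_norm v ^+ 2 = \sum_(i < d) v 0 i ^+ 2.
Proof. by rewrite sqr_sqrtr// sumr_ge0// => i _; exact: sqr_ge0. Qed.

Lemma eucl_norm_ge0 v : 0 <= eucl_norm v.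
Proof. exact: sqrtr_ge0. Qed.

Lemma eucl_norm0_eq0 v : eucl_norm v = 0 -> v = 0.
Proof.
move=> v0; apply/rowP => i; rewrite mxE; apply/eqP.
have /eqP := eucl_norm_sq v; rewrite v0 expr0n/= eq_sym psumr_eq0.
  by move=> /allP/(_ i (mem_index_enum i))/=; rewrite sqrf_eq0.
by move=> j _; exact: sqr_ge0.
Qed.

Lemma eucl_norm0 : eucl_norm (0 : 'rV[R]_d) = 0.
Proof.
rewrite /eucl_norm big1 ?sqrtr0// => i _.
by rewrite mxE expr0n.
Qed.

Lemma eucl_normZ k v : eucl_norm (k *: v) = `|k| * eucl_norm v.
Proof.
rewrite /eucl_norm -sqrtr_sqr -sqrtrM ?sqr_ge0// mulr_sumr.
by congr Num.sqrt; apply: eq_bigr => i _; rewrite mxE exprMn.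
Qed.

Lemma eucl_normN v : eucl_norm (- v) = eucl_norm v.
Proof. by rewrite -scaleN1r eucl_normZ normrN1 mul1r. Qed.

(** Young's inequality [(a + b)^2 <= (1 + t) a^2 + (1 + s) b^2] with [t s = 1] is summed over the
    coordinates. For [t = |v| / |u|] the right-hand side adds up to exactly [(|u| + |v|)^2]. *)
Lemma eucl_normD u v : eucl_norm (u + v) <= eucl_norm u + eucl_norm v.
Proof.
have [u0|u0] := eqVneq (eucl_norm u) 0.
  by rewrite (eucl_norm0_eq0 u0) add0r eucl_norm0 add0r.
have [v0|v0] := eqVneq (eucl_norm v) 0.
  by rewrite (eucl_norm0_eq0 v0) addr0 eucl_norm0 addr0.
have up : 0 < eucl_norm u by rewrite lt_neqAle eq_sym u0 eucl_norm_ge0.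
have vp : 0 < eucl_norm v by rewrite lt_neqAle eq_sym v0 eucl_norm_ge0.
rewrite -(@ler_pXn2r _ 2)// ?nnegrE ?addr_ge0 ?eucl_norm_ge0//.
pose t := eucl_norm v / eucl_norm u; pose s := eucl_norm u / eucl_norm v.
have t0 : 0 < t by rewrite divr_gt0.
have ts : t * s = 1 by rewrite /t /s; field; rewrite u0 v0.
apply: (@le_trans _ _ (\sum_(i < d) ((1 + t) * u 0 i ^+ 2 + (1 + s) * v 0 i ^+ 2))).
  rewrite eucl_norm_sq; apply: ler_sum => i _; rewrite mxE -subr_ge0.
  rewrite [leRHS](_ : _ = t * (u 0 i - s * v 0 i) ^+ 2).
    by rewrite mulr_ge0 ?sqr_ge0// ltW.
  have -> : t * (u 0 i - s * v 0 i) ^+ 2 = t * u 0 i ^+ 2 - (t * s) * u 0 i * v 0 i *+ 2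
     + (t * s) * s * v 0 i ^+ 2 by ring.
  by rewrite ts; ring.
rewrite big_split/= -!mulr_sumr -!eucl_norm_sq /t /s.
by rewrite le_eqVlt; apply/orP; left; apply/eqP; field; rewrite u0 v0.
Qed.

Lemma eucl_distC x y : eucl_dist x y = eucl_dist y x.
Proof. by rewrite /eucl_dist -eucl_normN opprB. Qed.

Lemma eucl_dist_ge0 x y : 0 <= eucl_dist x y.
Proof. exact: eucl_norm_ge0. Qed.

Lemma eucl_distxx x : eucl_dist x x = 0.
Proof. by rewrite /eucl_dist subrr eucl_norm0. Qed.

Lemma eucl_dist_triangle y x z : eucl_dist x z <= eucl_dist x y + eucl_dist y z.
Proof. by rewrite /eucl_dist (le_trans _ (eucl_normD _ _))// addrA subrK. Qed.

Lemma eucl_norm_continuous : continuous (@eucl_norm R d).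
Proof.
move=> v; apply: (@continuous_comp _ _ _ (fun v : 'rV[R]_d => \sum_(i < d) v 0 i ^+ 2)
  (@Num.sqrt R)); last exact: sqrt_continuous.
elim: (index_enum _) => [|i s ih].
  rewrite [X in {for _, continuous X}](_ : _ = fun=> 0); first exact: cst_continuous.
  by apply/funext => u; rewrite big_nil.
rewrite [X in {for _, continuous X}](_ : _ = fun u : 'rV[R]_d =>
    u 0 i * u 0 i + \sum_(j <- s) u 0 j ^+ 2).
  by apply: cvgD ih; apply: cvgM; exact: coord_continuous.
by apply/funext => u; rewrite big_cons expr2.
Qed.

Lemma eucl_dist_continuous : continuous (fun z : 'rV[R]_d * 'rV[R]_d => eucl_dist z.1 z.2).
Proof.
move=> z; apply: (@continuous_comp _ _ _ (fun z : 'rV[R]_d * 'rV[R]_d => z.1 - z.2)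
  (@eucl_norm R d)); last exact: eucl_norm_continuous.
by apply: cvgB; [exact: cvg_fst|exact: cvg_snd].
Qed.

Lemma eucl_dist_continuousl y : continuous (fun x => eucl_dist x y).
Proof.
move=> x; apply: (@continuous_comp _ _ _ (fun x : 'rV[R]_d => x - y) (@eucl_norm R d)).
  exact: (cvgB cvg_id (cvg_cst _)).
exact: eucl_norm_continuous.
Qed.

Lemma eucl_lipschitz_continuous (h : 'rV[R]_d -> R) k :
  eucl_lipschitz_on setT k h -> continuous h.
Proof.
move=> hl x; apply/(@cvgrPdist_le _ _ _ (nbhs x)) => e e0.
have : k * eucl_dist y x @[y --> x] --> k * eucl_dist x x.
  by apply: (@cvgMl_tmp _ _ (nbhs x)); exact: (@eucl_dist_continuousl x x).
rewrite eucl_distxx mulr0 => /(cvgr_le _)/(_ e e0); apply: filterS => y.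
by apply: le_trans; rewrite eucl_distC; exact: hl.
Qed.

End euclidean.

Section domain.
Context (R : realType) (d : nat).
Local Notation V := 'rV[R]_d.
Implicit Types (x y p q : V) (A Omega : set V).

(** McShane's formula: [h x] is the infimum of [g z + |x - z|] over [z] in [A]. A base point [a] of
    [A] bounds it below by [g a - |a - x|]. *)
Lemma mcshane_extension A (g : V -> R) : eucl_lipschitz_on A 1 g ->
  exists h : V -> R, eucl_lipschitz_on setT 1 h /\ forall x, A x -> h x = g x.
Proof.
have [->|/set0P[a Aa]] := eqVneq A set0.
  by exists (fun=> 0); split => // x y _ _; rewrite subrr normr0 mul1r eucl_dist_ge0.
move=> gl; pose S x := [set g z + eucl_dist x z | z in A].
have gle z w : A z -> A w -> g z <= g w + eucl_dist z w.
  move=> Az Aw; have := gl z w Az Aw; rewrite mul1r => /ler_normlP[_]; lra.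
have lbS x : has_lbound (S x).
  exists (g a - eucl_dist a x) => _ [z Az <-].
  have := gle a z Aa Az; have := eucl_dist_triangle x a z; lra.
have S0 x : S x !=set0 by exists (g a + eucl_dist x a); exists a.
have hle x y : inf (S x) <= inf (S y) + eucl_dist x y.
  rewrite -lerBlDr; apply: lb_le_inf => // _ [z Az <-].
  have : inf (S x) <= g z + eucl_dist x z by apply: ge_inf => //; exists z.
  have := eucl_dist_triangle y x z; lra.
exists (fun x => inf (S x)); split.
  move=> x y _ _; rewrite mul1r; apply/ler_normlP.
  have := hle x y; have := hle y x; rewrite (eucl_distC y x); split; lra.
move=> x Ax; apply/eqP; rewrite eq_le; apply/andP; split.
  by apply: ge_inf => //; exists x => //; rewrite eucl_distxx addr0.
by apply: lb_le_inf => // _ [z Az <-]; exact: gle.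
Qed.

Lemma open_boundaryE Omega : open Omega -> boundary Omega = closure Omega `\` Omega.
Proof. by rewrite /boundary => /interior_id ->. Qed.

Lemma closure_setUboundary Omega : open Omega -> closure Omega = Omega `|` boundary Omega.
Proof.
move=> oO; rewrite (open_boundaryE oO) setDE setUIr setUCr setIT.
by apply/esym/setUidPr; exact: subset_closure.
Qed.

Definition seg x y (s : R) : V := (1 - s) *: x + s *: y.

Lemma seg_continuous x y : continuous (seg x y).
Proof.
move=> s; apply: (@cvgD _ _ _ (nbhs s)).
  by apply: (@cvgZr_tmp _ _ _ (nbhs s)); apply: cvgB; [exact: cvg_cst|exact: cvg_id].
by apply: (@cvgZr_tmp _ _ _ (nbhs s)); exact: cvg_id.
Qed.

Lemma segC x y s : seg y x s = seg x y (1 - s).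
Proof. by rewrite /seg opprB addrCA subrr addr0 addrC. Qed.

Lemma eucl_dist_seg x y s t : eucl_dist (seg x y s) (seg x y t) = `|t - s| * eucl_dist x y.
Proof.
rewrite /eucl_dist -eucl_normZ; congr eucl_norm.
by apply/rowP => i; rewrite !mxE; ring.
Qed.

Lemma seg0 x y : seg x y 0 = x.
Proof. by rewrite /seg subr0 scale1r scale0r addr0. Qed.

Lemma seg1 x y : seg x y 1 = y.
Proof. by rewrite /seg subrr scale1r scale0r add0r. Qed.

(** Take [s] to be the largest parameter in [[0, t]] whose point is in the closure. Were that point
    in the open [Omega], slightly larger parameters would qualify too. *)
Lemma seg_leaves Omega x y t : open Omega -> closure Omega x -> 0 <= t ->
  ~ closure Omega (seg x y t) -> exists s, 0 <= s < t /\ boundary Omega (seg x y s).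
Proof.
move=> oO cx t0 nt.
pose S := `[0, t]%classic `&` (seg x y @^-1` closure Omega).
have cS : compact S.
  apply: compact_closedI; first exact: segment_compact.
  by apply: closed_comp; [move=> s _; exact: seg_continuous|exact: closed_closure].
have S0 : S !=set0 by exists 0; split; rewrite /= ?in_itv/= ?lexx ?t0// seg0.
have cid : {within S, continuous (@id R)}.
  by apply: continuous_subspaceT => u; exact: cvg_id.
have [s /set_mem[sI Ps] smax] := compact_EVT_max S0 cS cid.
have /andP[s0 st] : 0 <= s <= t by move: sI; rewrite /= in_itv.
have slt : s < t.
  by rewrite lt_neqAle st andbT; apply/eqP => ste; apply: nt; rewrite -ste.
exists s; split; first by rewrite s0.
rewrite (open_boundaryE oO); split; [exact: Ps|move=> Os].
have nO : \forall u \near s, Omega (seg x y u).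
  exact: (@seg_continuous x y s _ (open_nbhs_nbhs (conj oO Os))).
have /nbhs_ballP[e /= e0 eO] := nO.
have [m [m0 me mt]] : exists m : R, [/\ 0 < m, m < e & m < t - s].
  exists (Num.min e (t - s) / 2).
  have : Num.min e (t - s) <= e by rewrite ge_min lexx.
  have : Num.min e (t - s) <= t - s by rewrite ge_min lexx orbT.
  have : 0 < Num.min e (t - s) by rewrite lt_min e0 subr_gt0 slt.
  by move=> h0 h1 h2; split; lra.
pose u := s + m.
have su : s < u by rewrite /u; lra.
have ut : u < t by rewrite /u; lra.
have Ou : Omega (seg x y u).
  by apply: eO; rewrite -ball_normE /ball_/= /u opprD addrA subrr sub0r normrN gtr0_norm.
have : u <= s.
  apply: smax; apply: mem_set; split; last exact: (subset_closure Ou).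
  by rewrite /= in_itv/= (ltW ut) (le_trans s0 (ltW su)).
by rewrite leNgt su.
Qed.

(** [seg_leaves] is applied from both ends, the second time along the reversed segment with
    parameter [1 - t]. The parameters satisfy [s < t < 1 - r], so [p] comes strictly before [q] on
    the segment and the lengths add up. *)
Lemma exit_points Omega x y t : open Omega -> closure Omega x -> closure Omega y ->
  0 <= t <= 1 -> ~ closure Omega (seg x y t) ->
  exists p q, [/\ boundary Omega p, boundary Omega q, 0 < eucl_dist p q &
    eucl_dist x p + eucl_dist p q + eucl_dist q y = eucl_dist x y].
Proof.
move=> oO cx cy /andP[t0 t1] nt.
have [s [/andP[s0 st] bs]] := seg_leaves oO cx t0 nt.
have [||r [/andP[r0 rt]]] := @seg_leaves Omega y x (1 - t) oO cy.
- by rewrite subr_ge0.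
- by rewrite segC subKr.
rewrite segC => br.
have xy : 0 < eucl_dist x y.
  rewrite lt_neqAle eucl_dist_ge0 andbT eq_sym; apply/eqP => /eucl_norm0_eq0/eqP.
  rewrite subr_eq0 => /eqP xy; apply: nt.
  by rewrite /seg -xy -scalerDl subrK scale1r.
exists (seg x y s), (seg x y (1 - r)); split => //.
  by rewrite eucl_dist_seg mulr_gt0// normr_gt0 subr_eq0 gt_eqF//; lra.
rewrite -[X in eucl_dist X (seg _ _ s)](seg0 x y).
rewrite -[X in eucl_dist (seg x y (1 - r)) X](seg1 x y).
by rewrite !eucl_dist_seg !ger0_norm; lra.
Qed.

Lemma compact_closure_bounded Omega : bounded_set Omega -> compact (closure Omega).
Proof.
move=> bO; apply: bounded_closed_compact; last exact: closed_closure.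
case: bO => M [Mr OM]; exists M; split=> // N /OM ON.
have cl : closed [set z : V | `|z| <= N].
  apply: (@closed_comp V R (fun z : V => `|z|) [set r | r <= N]); last exact: closed_le.
  by move=> z _; exact: norm_continuous.
by move=> z cz; move: (closureS ON cz); rewrite -(closure_id _).1.
Qed.

(** A point whose first coordinate exceeds the maximum over the compact closure is outside, so a
    segment towards it must cross the boundary. *)
Lemma boundary_nonempty Omega : (0 < d)%N -> open Omega -> Omega !=set0 ->
  bounded_set Omega -> boundary Omega !=set0.
Proof.
move=> d0 oO [x Ox] bO; pose i0 := Ordinal d0.
have cx := subset_closure Ox.
have cc : {within closure Omega, continuous (fun z : V => z 0 i0)}.
  by apply: continuous_subspaceT => z; exact: coord_continuous.
have [c _ cmax] := compact_EVT_max (ex_intro _ x cx) (compact_closure_bounded bO) cc.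
have [||s [_ bs]] := @seg_leaves Omega x (const_mx (c 0 i0 + 1)) 1 oO cx => //; last first.
  by exists (seg x (const_mx (c 0 i0 + 1)) s).
rewrite seg1 => /mem_set/cmax; rewrite mxE; lra.
Qed.

End domain.

(** * Admissible plans *)

Lemma finite_measure_of d (T : measurableType d) (R : realType)
    (m : {measure set T -> \bar R}) : fin_num_fun m ->
  exists nu : {finite_measure set T -> \bar R}, (nu : set T -> \bar R) = m.
Proof.
move=> fm.
have sg : sigma_finite setT m by apply: fin_num_fun_sigma_finite => //; rewrite measure0.
have sf : sfinite_measure m by exact: sfinite_measure_sigma_finite.
pose f1 := @isSFinite.Build _ T R (Measure.sort m) sf.
pose f2 := @isSigmaFinite.Build _ T R (Measure.sort m) sg.
pose f3 := @isFinite.Build _ T R (Measure.sort m) fm.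
pose nu : {finite_measure set T -> \bar R} := HB.pack (Measure.sort m) f1 f2 f3.
by exists nu.
Qed.

Section finite_measure_operations.
Context d d' (T : measurableType d) (T' : measurableType d') (R : realType).
Local Open Scope ereal_scope.

(** This operation and the two below return a finite measure known only by its values and its
    integrals of nonnegative functions; competing plans are assembled from these facts. *)
Lemma finite_pushforward (mu : {finite_measure set T -> \bar R}) (f : T -> T') :
  measurable_fun setT f ->
  exists nu : {finite_measure set T' -> \bar R},
    (forall A, nu A = mu (f @^-1` A)) /\
    forall D g, measurable D -> measurable_fun D g -> (forall y, D y -> 0 <= g y) ->
      \int[nu]_(y in D) g y = \int[mu]_(x in f @^-1` D) g (f x).
Proof.
move=> mf.
pose m := measure_function_pushforward__canonical__measure_function_Measure mu mf.
have fm : fin_num_fun m.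
  move=> A mA; apply: (fin_num_measure mu).
  by rewrite -[X in measurable X]setTI; exact: (mf).
have [nu nuE] := finite_measure_of fm.
exists nu; rewrite nuE; split=> [//|D g mD mg g0]; rewrite ge0_integral_pushforward//.
by move=> y /set_mem; exact: g0.
Qed.

Lemma finite_measure_add (mu1 mu2 : {finite_measure set T -> \bar R}) :
  exists nu : {finite_measure set T -> \bar R},
    (forall A, nu A = mu1 A + mu2 A) /\
    forall D g, measurable D -> measurable_fun D g -> (forall y, D y -> 0 <= g y) ->
      \int[nu]_(y in D) g y = \int[mu1]_(y in D) g y + \int[mu2]_(y in D) g y.
Proof.
pose m := measure_add mu1 mu2.
have fm : fin_num_fun m.
  by move=> A mA; rewrite /m measure_addE fin_numD !fin_num_measure.
have [nu nuE] := finite_measure_of fm.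
exists nu; rewrite nuE; split=> [A|D g mD mg g0]; first by rewrite -measure_addE.
by rewrite -ge0_integral_measure_add.
Qed.

Lemma finite_restriction (mu : {finite_measure set T -> \bar R}) (U : set T) :
  measurable U ->
  exists nu : {finite_measure set T -> \bar R},
    (forall A, nu A = mu (A `&` U)) /\
    forall D g, measurable D -> measurable_fun D g -> (forall y, D y -> 0 <= g y) ->
      \int[nu]_(y in D) g y = \int[mu]_(y in D `&` U) g y.
Proof.
move=> mU; pose nu : {finite_measure set T -> \bar R} := mrestr mu mU.
exists nu; split=> [//|D g mD mg g0].
rewrite (@ge0_negligible_integral _ _ _ nu D (~` U))//.
- rewrite setDE setCK; apply: eq_measure_integral => A mA AU.
  by congr (mu _); apply/setIidPl => x /AU[].
- exact: measurableC.
- by rewrite /nu/= /mrestr setICl measure0.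
Qed.

End finite_measure_operations.

Lemma continuous_pair (S T U : topologicalType) (f : S -> T) (g : S -> U) :
  continuous f -> continuous g -> continuous (fun x => (f x, g x)).
Proof.
move=> cf cg x.
exact: (@cvg_pair _ _ _ (nbhs x) (nbhs (f x)) (nbhs (g x)) _ _ _ f g (cf x) (cg x)).
Qed.

Section plans.
Import PairTopology.
Context (R : realType) (d : nat).
Local Notation V := 'rV[R]_d.
Local Notation VV := (V * V)%type.
Variables (Omega : set V) (fp fm : {finite_measure set (borel V) -> \bar R}).
Hypothesis oO : open Omega.
Implicit Types (gamma : {finite_measure set (borel VV) -> \bar R}) (p q x y : V).

Local Notation D := (closure Omega `*` closure Omega).
Local Notation adm := (admissible Omega fp fm).

Lemma closed_plan_domain : closed D.
Proof.
rewrite (_ : D = fst @^-1` closure Omega `&` snd @^-1` closure Omega)//.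
by apply: closedI; apply: closed_comp; rewrite ?closed_closure//;
  [move=> z _; exact: cvg_fst|exact: closed_closure|
   move=> z _; exact: cvg_snd|exact: closed_closure].
Qed.

Lemma measurable_plan_domain : measurable (D : set (borel VV)).
Proof. exact: (closed_borel closed_plan_domain). Qed.

Lemma boundary_closure p : boundary Omega p -> closure Omega p.
Proof. by case. Qed.

Lemma boundary_notin p : boundary Omega p -> ~ Omega p.
Proof. by rewrite open_boundaryE// => -[]. Qed.

Lemma measurable_preimage_fst (A : set (borel V)) : measurable A ->
  measurable (fst @^-1` A : set (borel VV)).
Proof.
move=> mA; rewrite -[X in measurable X]setTI.
by apply: (@continuous_map_borel_measurable VV V setT fst) => // z; exact: cvg_fst.
Qed.

Lemma measurable_preimage_snd (A : set (borel V)) : measurable A ->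
  measurable (snd @^-1` A : set (borel VV)).
Proof.
move=> mA; rewrite -[X in measurable X]setTI.
by apply: (@continuous_map_borel_measurable VV V setT snd) => // z; exact: cvg_snd.
Qed.

Lemma send_fst_continuous p : continuous (fun z : VV => (z.1, p)).
Proof. by apply: continuous_pair => z; [exact: cvg_fst|exact: cvg_cst]. Qed.

Lemma send_snd_continuous q : continuous (fun z : VV => (q, z.2)).
Proof. by apply: continuous_pair => z; [exact: cvg_cst|exact: cvg_snd]. Qed.

(** The competitor keeps [gamma] off [U] and replaces its part on [U] by the images under
    [(x, y) -> (x, p)] and [(x, y) -> (q, y)]. The first preserves the first marginal and the second
    preserves the second. The new endpoints lie on the boundary, where marginals are
    unconstrained. *)
Lemma admissible_split gamma (U : set (borel VV)) p q :
  adm gamma -> measurable U -> U `<=` D -> boundary Omega p -> boundary Omega q ->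
  exists gamma', adm gamma' /\ forall phi : VV -> R, continuous phi ->
    (forall z, 0 <= phi z) ->
    (\int[gamma']_(z in (D : set (borel VV))) (phi z)%:E =
     \int[gamma]_(z in (D `\` U : set (borel VV))) (phi z)%:E +
     (\int[gamma]_(z in U) (phi (z.1, p))%:E +
      \int[gamma]_(z in U) (phi (q, z.2))%:E))%E.
Proof.
move=> [g0 gx gy] mU UD bp bq.
have mD := measurable_plan_domain.
have mT1 : measurable_fun setT ((fun z : VV => (z.1, p)) : borel VV -> borel VV).
  by apply: continuous_map_borel_measurable => //; exact: send_fst_continuous.
have mT2 : measurable_fun setT ((fun z : VV => (q, z.2)) : borel VV -> borel VV).
  by apply: continuous_map_borel_measurable => //; exact: send_snd_continuous.
have [n1 [n1E n1I]] := finite_restriction gamma (measurableC mU).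
have [nU [nUE nUI]] := finite_restriction gamma mU.
have [n2 [n2E n2I]] := finite_pushforward nU mT1.
have [n3 [n3E n3I]] := finite_pushforward nU mT2.
have [n12 [n12E n12I]] := finite_measure_add n1 n2.
have [g' [g'E g'I]] := finite_measure_add n12 n3.
have gE (A : set (borel VV)) : g' A = (gamma (A `&` ~` U) +
    gamma ([set z | A (z.1, p)] `&` U) + gamma ([set z | A (q, z.2)] `&` U))%E.
  by rewrite g'E n12E n1E n2E n3E !nUE.
have gIU (A : set (borel VV)) : measurable A ->
    (gamma (A `&` ~` U) + gamma (A `&` U) = gamma A)%E.
  by move=> mA; rewrite [RHS](measureDI _ mA mU) setDE.
have mOmega (A : set (borel V)) : measurable A -> measurable (A `&` Omega : set (borel V)).
  by move=> mA; apply: measurableI => //; exact: open_borel.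
exists g'; split; first split.
- rewrite /concentrated_on gE.
  rewrite (_ : [set z | (~` D) (z.1, p)] `&` U = set0); last first.
    apply/seteqP; split=> // z [/= nz /UD[z1 _]]; apply: nz.
    by split => //; exact: boundary_closure.
  rewrite (_ : [set z | (~` D) (q, z.2)] `&` U = set0); last first.
    apply/seteqP; split=> // z [/= nz /UD[_ z2]]; apply: nz.
    by split => //; exact: boundary_closure.
  rewrite measure0 !adde0; apply: (@subset_measure0 _ (borel VV) _ gamma _ (~` D)) => //.
  + by apply: measurableI; exact: measurableC.
  + exact: measurableC.
- move=> A mA; rewrite -(gx A mA) /marginal_x /pushforward gE.
  (* The mass sent to [(q, y)] has first coordinate outside [Omega], so the first marginal does not
     see it there. *)
  rewrite [X in (_ + X)%E](_ : _ = 0%E); last first.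
    rewrite (_ : _ `&` U = set0) ?measure0//.
    by apply/seteqP; split=> // z [/= [_ /boundary_notin]].
  rewrite adde0 -[RHS](gIU (fst @^-1` (A `&` Omega)))//.
  by apply: measurable_preimage_fst; exact: mOmega.
- move=> A mA; rewrite -(gy A mA) /marginal_y /pushforward gE.
  rewrite [X in (_ + X + _)%E](_ : _ = 0%E); last first.
    rewrite (_ : _ `&` U = set0) ?measure0//.
    by apply/seteqP; split=> // z [/= [_ /boundary_notin]].
  rewrite adde0 -[RHS](gIU (snd @^-1` (A `&` Omega)))//.
  by apply: measurable_preimage_snd; exact: mOmega.
move=> phi cphi phi0.
have mphi (S : set (borel VV)) : measurable S ->
    measurable_fun S (EFin \o phi : borel VV -> \bar R).
  by move=> mS; apply/measurable_EFinP; exact: continuous_borel_measurable.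
have phiE z : (0 <= (phi z)%:E)%E by rewrite lee_fin.
rewrite g'I//; last exact: mphi.
rewrite n12I//; last exact: mphi.
rewrite n1I//; last exact: mphi.
rewrite n2I//; last exact: mphi.
rewrite n3I//; last exact: mphi.
have mpre (f : VV -> VV) : continuous f -> measurable (f @^-1` D : set (borel VV)).
  move=> cf; apply: closed_borel; apply: closed_comp; last exact: closed_plan_domain.
  by move=> z _; exact: cf.
have mcomp (f : VV -> VV) (S : set (borel VV)) : measurable S -> continuous f ->
    measurable_fun S (fun z => (phi (f z))%:E : \bar R).
  move=> mS cf; apply/measurable_EFinP.
  apply: (@continuous_borel_measurable _ VV S (phi \o f)) => //.
  by move=> z; apply: continuous_comp; [exact: cf|exact: cphi].
rewrite nUI//; last 2 first.
  exact: (mpre _ (@send_fst_continuous p)).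
  by apply: (mcomp _ _ _ (@send_fst_continuous p)); exact: (mpre _ (@send_fst_continuous p)).
rewrite nUI//; last 2 first.
  exact: (mpre _ (@send_snd_continuous q)).
  by apply: (mcomp _ _ _ (@send_snd_continuous q)); exact: (mpre _ (@send_snd_continuous q)).
rewrite setDE addeA; congr (_ + _ + _)%E.
- congr (integral _ _ _); apply/setIidPr => z /UD[z1 _].
  by split => //; exact: boundary_closure.
- congr (integral _ _ _); apply/setIidPr => z /UD[_ z2].
  by split => //; exact: boundary_closure.
Qed.

(** Only the pairs with at least one coordinate in [Omega] are kept. Their mass is at most the sum
    of the two prescribed marginal masses, and restriction cannot raise a nonnegative cost. *)
Lemma admissible_reduce gamma : adm gamma ->
  exists gamma', [/\ adm gamma',
    (gamma' setT <= fp setT + fm setT)%E &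
    forall phi : VV -> R, continuous phi -> (forall z, 0 <= phi z) ->
    (\int[gamma']_(z in (D : set (borel VV))) (phi z)%:E <=
     \int[gamma]_(z in (D : set (borel VV))) (phi z)%:E)%E].
Proof.
move=> [g0 gx gy].
have mD := measurable_plan_domain.
have mO : measurable (Omega : set (borel V)) by exact: open_borel.
have mfst := measurable_preimage_fst mO.
have msnd := measurable_preimage_snd mO.
have mW := measurableU _ _ mfst msnd.
have [g' [g'E g'I]] := finite_restriction gamma mW.
exists g'; split; first split.
- rewrite /concentrated_on g'E; apply: (@subset_measure0 _ (borel VV) _ gamma _ (~` D)) => //.
  + by apply: measurableI => //; exact: measurableC.
  + exact: measurableC.
- move=> A mA; rewrite -(gx A mA) /marginal_x /pushforward g'E; congr (gamma _).
  by apply/setIidPl => z [_ ?]; left.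
- move=> A mA; rewrite -(gy A mA) /marginal_y /pushforward g'E; congr (gamma _).
  by apply/setIidPl => z [_ ?]; right.
- rewrite g'E setTI; apply: (le_trans (measureU2 _ mfst msnd)).
  by rewrite -(gx _ measurableT) -(gy _ measurableT) /marginal_x /marginal_y /pushforward !setTI.
move=> phi cphi phi0.
have mphi (S : set (borel VV)) : measurable S ->
    measurable_fun S (EFin \o phi : borel VV -> \bar R).
  by move=> mS; apply/measurable_EFinP; exact: continuous_borel_measurable.
have phiE z : (0 <= (phi z)%:E)%E by rewrite lee_fin.
rewrite g'I//; last exact: mphi.
apply: ge0_subset_integral => //; [exact: measurableI|exact: mphi].
Qed.

(** All of [fp] is sent to the boundary point [p] and all of [fm] is drawn from it. *)
Lemma admissible_exists p : boundary Omega p ->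
  concentrated_on Omega fp -> concentrated_on Omega fm -> exists gamma, adm gamma.
Proof.
move=> bp fp0 fm0.
have mO : measurable (Omega : set (borel V)) by exact: open_borel.
have mT1 : measurable_fun setT ((fun x : V => (x, p)) : borel V -> borel VV).
  apply: (@continuous_map_borel_measurable V VV) => //.
  by apply: (@continuous_pair _ _ _ id (cst p)); [move=> x; exact: cvg_id|exact: cst_continuous].
have mT2 : measurable_fun setT ((fun x : V => (p, x)) : borel V -> borel VV).
  apply: (@continuous_map_borel_measurable V VV) => //.
  by apply: (@continuous_pair _ _ _ (cst p) id); [exact: cst_continuous|move=> x; exact: cvg_id].
have [n1 [n1E _]] := finite_pushforward fp mT1.
have [n2 [n2E _]] := finite_pushforward fm mT2.
have [g [gE _]] := finite_measure_add n1 n2.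
have mnD : measurable (~` (closure Omega) : set (borel V)).
  exact: (measurableC (closed_borel (@closed_closure _ Omega))).
have nOc : ~` closure Omega `<=` ~` Omega by apply: subsetC; exact: subset_closure.
exists g; split.
- rewrite /concentrated_on gE n1E n2E.
  rewrite [X in (X + _)%E](_ : _ = 0%E); last first.
    apply: (@subset_measure0 _ (borel V) _ _ _ (~` Omega)) => //.
    + rewrite (_ : _ @^-1` _ = ~` closure Omega)//.
      apply/seteqP; split=> x /= nx h; apply: nx; last by case: h.
      by split => //; exact: boundary_closure.
    + exact: measurableC.
    + move=> x /= nx Ox; apply: nx; split; [exact: subset_closure|exact: boundary_closure].
  rewrite add0e.
  apply: (@subset_measure0 _ (borel V) _ _ _ (~` Omega)) => //.
  + rewrite (_ : _ @^-1` _ = ~` closure Omega)//.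
    apply/seteqP; split=> x /= nx h; apply: nx; last by case: h.
    by split => //; exact: boundary_closure.
  + exact: measurableC.
  + move=> x /= nx Ox; apply: nx; split; [exact: boundary_closure|exact: subset_closure].
- move=> A mA; rewrite /marginal_x /pushforward gE n1E n2E.
  rewrite [X in (_ + X)%E](_ : _ = 0%E); last first.
    rewrite (_ : _ @^-1` _ = set0) ?measure0//.
    by apply/seteqP; split=> // z [_ /boundary_notin].
  by rewrite adde0 -[RHS](measureI_conc mA mO fp0).
- move=> A mA; rewrite /marginal_y /pushforward gE n1E n2E.
  rewrite [X in (X + _)%E](_ : _ = 0%E); last first.
    rewrite (_ : _ @^-1` _ = set0) ?measure0//.
    by apply/seteqP; split=> // z [_ /boundary_notin].
  by rewrite add0e -[RHS](measureI_conc mA mO fm0).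
Qed.

End plans.

(** * Null sets, inner regularity and identification of marginals *)

Lemma cvg_cst_eq (R : realType) (F : set_system nat) (u : nat -> R) (a c : R) :
  ProperFilter F -> (forall n, u n = c) -> u n @[n --> F] --> a -> a = c.
Proof.
move=> PF uc ua; apply/eqP; rewrite eq_le; apply/andP; split.
  by apply: (cvgr_to_le ua); apply: filterE => n; rewrite uc.
by apply: (cvgr_to_ge ua); apply: filterE => n; rewrite uc.
Qed.

(** Each point of [C] has a null open neighbourhood, and finitely many of these cover [C]. *)
Lemma null_off_spt (R : realType) (T : ptopologicalType)
    (mu : {finite_measure set (borel T) -> \bar R}) (C : set T) :
  compact C -> (forall z, C z -> ~ spt mu z) -> hausdorff_space T -> mu C = 0%E.
Proof.
move=> cC nspt hT.
have /choice[U UP] z : exists U : set T, C z -> [/\ open U, U z & mu U = 0%E].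
  have [Cz|//] := pselect (C z); last by exists set0.
  have /existsNP[U /not_implyP[oU /not_implyP[Uz U0]]] := nspt z Cz.
  exists U => _; split => //; apply/eqP; rewrite eq_le measure_ge0 andbT leNgt.
  exact/negP.
have := cC; rewrite compact_cover => /(_ T C U) [z /UP[]//|z Cz|X XC CX].
  by exists z => //; have [] := UP z Cz.
have XU : forall s : seq T, (forall z, z \in s -> C z) ->
    measurable (\big[setU/set0]_(z <- s) U z : set (borel T)) /\
    mu (\big[setU/set0]_(z <- s) U z) = 0%E.
  elim=> [|z s ih] sC; first by rewrite big_nil measure0; split => //; exact: measurable0.
  have [mU U0] : measurable (U z : set (borel T)) /\ mu (U z) = 0%E.
    by have [oU _ ->] := UP z (sC z (mem_head _ _)); split => //; exact: open_borel.
  have [ms s0] := ih (fun w ws => sC w (mem_behead (s := z :: s) ws)).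
  rewrite big_cons; split; first exact: measurableU.
  exact: null_set_setU.
have [] := XU (finmap.enum_fset X); first by move=> z zX; apply/set_mem/XC.
move: CX; rewrite /cover bigcup_fset => CX mX X0.
by apply: (subset_measure0 _ mX CX X0); apply: closed_borel; exact: compact_closed.
Qed.

Section inner_regularity.
Context (R : realType) (d : nat).
Local Notation V := 'rV[R]_d.
Variables (W K : set V).
Hypotheses (oW : open W) (cK : compact K) (WK : W `<=` K).

(* The points at distance at least 1/(n+1) from the complement of W. *)
Definition inner_core n : set V := ~` \bigcup_(y in ~` W) ball y n.+1%:R^-1.

Lemma inner_core_sub n : inner_core n `<=` W.
Proof.
move=> x nx; apply: contrapT => Wx; apply: nx; exists x => //.
by apply: ballxx; rewrite invr_gt0.
Qed.

Lemma inner_core_compact n : compact (inner_core n).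
Proof.
rewrite -(setIidr (subset_trans (@inner_core_sub n) WK)).
apply: compact_closedI => //; apply: open_closedC; apply: bigcup_open => y _.
exact: ball_open.
Qed.

Lemma inner_core_nondecreasing : nondecreasing_seq inner_core.
Proof.
move=> m n mn; apply/subsetPset; apply: subsetC => x [y Wy xy]; exists y => //.
by apply: le_ball xy; rewrite lef_pV2 ?posrE// ler_nat ltnS.
Qed.

Lemma bigcup_inner_core : \bigcup_n inner_core n = W.
Proof.
apply/seteqP; split=> [x [n _ /inner_core_sub//]|x Wx].
have /nbhs_ballP[e /= e0 eW] := open_nbhs_nbhs (conj oW Wx).
have [n ne] : exists n : nat, n.+1%:R^-1 <= e.
  exists (Num.trunc e^-1); rewrite invf_ple ?posrE//.
  by apply: ltW; rewrite truncnS_gt.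
exists n => // -[y Wy xy]; apply: Wy; apply: eW.
by apply: le_ball ne _ _; exact: ball_sym.
Qed.

(** The compact cores increase to [W], so continuity from below transfers the comparison. *)
Lemma inner_regular_le (mu nu : {finite_measure set (borel V) -> \bar R}) :
  (forall C, compact C -> C `<=` W -> (mu C <= nu C)%E) -> (mu W <= nu W)%E.
Proof.
move=> munu; have mW : measurable (W : set (borel V)) by exact: open_borel.
have mC n : measurable (inner_core n : set (borel V)).
  apply: closed_borel; apply: compact_closed; last exact: inner_core_compact.
  exact: norm_hausdorff.
have mcup : measurable (\bigcup_n inner_core n : set (borel V)).
  by rewrite bigcup_inner_core.
have cv := nondecreasing_cvg_mu mC mcup inner_core_nondecreasing (mu := mu).
rewrite -bigcup_inner_core -(cvg_lim _ cv)//.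
apply: lime_le; first by apply/cvg_ex; eexists; exact: cv.
apply: nearW => n; apply: (@le_trans _ _ (nu (inner_core n))).
  by apply: munu; [exact: inner_core_compact|exact: inner_core_sub].
apply: le_measure; rewrite ?inE//.
by apply: bigcup_sup.
Qed.

End inner_regularity.

(** Open sets form a generating pi-system, so agreement on each open [U] suffices. There one
    inequality is the hypothesis on open sets and the other follows from compact sets by inner
    regularity. *)
Lemma marginal_eq (R : realType) (d : nat) (Omega : set 'rV[R]_d)
    (mu nu : {finite_measure set (borel 'rV[R]_d) -> \bar R}) :
  open Omega -> compact (closure Omega) -> mu (~` Omega) = 0%E ->
  (forall U, open U -> U `<=` Omega -> (nu U <= mu U)%E) ->
  (forall C, compact C -> C `<=` Omega -> (mu C <= nu C)%E) ->
  forall A : set (borel 'rV[R]_d), measurable A -> nu (A `&` Omega) = mu A.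
Proof.
move=> oO cK mu0 numu munu A mA.
have mO : measurable (Omega : set (borel 'rV[R]_d)) by exact: open_borel.
have [n [nE _]] := finite_restriction nu mO.
rewrite -nE.
apply: (@measure_unique _ R (borel 'rV[R]_d) (open : set (set 'rV[R]_d))
  (fun=> setT) erefl _ _ _ n mu) => //.
- by move=> U V; exact: openI.
- by move=> _; exact: openT.
- by apply: bigcup_const.
- move=> U oU; transitivity (nu (U `&` Omega)); first exact: nE.
  rewrite -(measureI_conc (open_borel oU) mO mu0).
  have oUO : open (U `&` Omega) by exact: openI.
  apply/eqP; rewrite eq_le; apply/andP; split.
    by apply: numu => //; exact: subIsetr.
  apply: (@inner_regular_le R d _ (closure Omega)) => //.
    by move=> x [_]; exact: subset_closure.
  by move=> C cC CU; apply: munu => // x /CU[].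
- by move=> _; rewrite ltey_eq fin_num_measure.
Qed.

(** * Minimizers of continuous costs *)

Section minimizers.
Import PairTopology.
Context (R : realType) (d : nat).
Local Notation V := 'rV[R]_d.
Local Notation VV := (V * V)%type.
Variables (Omega : set V) (fp fm : {finite_measure set (borel V) -> \bar R}).
Hypotheses (oO : open Omega) (cK : compact (closure Omega)).
Hypotheses (fp0 : concentrated_on Omega fp) (fm0 : concentrated_on Omega fm).
Implicit Types (gamma : {finite_measure set (borel VV) -> \bar R}) (p q x y : V).

Local Notation D := (closure Omega `*` closure Omega).
Local Notation adm := (admissible Omega fp fm).

Lemma hausdorff_plan : hausdorff_space VV.
Proof. exact: norm_hausdorff. Qed.

(** Here [f] is either projection. Along the sequence the marginal on [Omega] is constantly [nu], so
    [l] takes the values of [nu] on the relevant preimages, and the portmanteau inequalities give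
    the two bounds asked for by [marginal_eq]. *)
Lemma plan_marginal_eq (f : VV -> V) (gamma : nat -> {finite_measure set (borel VV) -> \bar R})
    (F : set_system nat) (l : set (borel VV) -> R)
    (mu : {finite_measure set (borel VV) -> \bar R})
    (nu : {finite_measure set (borel V) -> \bar R}) :
  ProperFilter F -> continuous f ->
  (forall n, concentrated_on D (gamma n)) ->
  (forall n (A : set (borel V)), measurable A -> gamma n (f @^-1` (A `&` Omega)) = nu A) ->
  (forall A, measurable A -> fine (gamma n A) @[n --> F] --> l A) ->
  (forall U : set VV, open U -> (mu U <= (l U)%:E)%E) ->
  (forall C : set VV, compact C -> ((l C)%:E <= mu C)%E) ->
  nu (~` Omega) = 0%E ->
  forall A : set (borel V), measurable A -> mu (f @^-1` (A `&` Omega)) = nu A.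
Proof.
move=> PF cf gD gnu gl muU muC nu0 A mA.
have mf : measurable_fun setT (f : borel VV -> borel V).
  exact: continuous_map_borel_measurable.
have [pi [piE _]] := finite_pushforward mu mf.
have mD := @measurable_plan_domain R d Omega.
have mpre (B : set (borel V)) : measurable B -> measurable (f @^-1` B : set (borel VV)).
  by move=> mB; rewrite -[X in measurable X]setTI; exact: (mf).
rewrite -piE; apply: (marginal_eq oO cK nu0) => //.
- move=> U oU UO; rewrite piE.
  have mU := open_borel oU.
  have -> : nu U = (l (f @^-1` U))%:E.
    rewrite (@cvg_cst_eq _ F _ _ (fine (nu U)) PF _ (gl _ (mpre _ mU))).
      by rewrite fineK// fin_num_measure.
    by move=> n; rewrite -(gnu n U mU) (setIidl UO).
  by apply: muU; apply: open_comp => // z _; exact: cf.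
- move=> C cC CO; rewrite piE.
  have clC : closed C by apply: compact_closed => //; exact: norm_hausdorff.
  have mC := closed_borel clC.
  (* The preimage of [C] is closed but may be unbounded; intersecting with [D], which carries all
     the mass, makes it compact. *)
  have cCD : compact (f @^-1` C `&` D).
    rewrite setIC; apply: compact_closedI; first exact: compact_setX.
    by apply: closed_comp => // z _; exact: cf.
  have mCD : measurable (f @^-1` C `&` D : set (borel VV)).
    by apply: measurableI => //; exact: mpre.
  have -> : nu C = (l (f @^-1` C `&` D))%:E.
    rewrite (@cvg_cst_eq _ F _ _ (fine (nu C)) PF _ (gl _ mCD)).
      by rewrite fineK// fin_num_measure.
    move=> n; rewrite -(gnu n C mC) (setIidl CO); congr fine.
    by apply: (measureI_conc (mpre _ mC) mD); exact: gD.
  apply: (le_trans (muC _ cCD)); apply: le_measure; rewrite ?inE//; exact: mpre.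
Qed.

Lemma admissible_limit (M : R) (gamma : nat -> {finite_measure set (borel VV) -> \bar R}) :
  (forall n, adm (gamma n)) -> (forall n, gamma n setT <= M%:E)%E ->
  exists (F : set_system nat) (l : set (borel VV) -> R)
    (mu : {finite_measure set (borel VV) -> \bar R}),
  [/\ ProperFilter F /\ \oo `<=` F,
      forall A, measurable A -> fine (gamma n A) @[n --> F] --> l A,
      adm mu /\ (mu setT <= M%:E)%E &
      forall U : set VV, open U -> (mu U <= (l U)%:E)%E].
Proof.
move=> ga gM.
have [F [l [mu [[PF ooF] gl muM muU muC]]]] :=
  finite_measures_compact hausdorff_plan (@pseudometric_normal R _) gM.
exists F, l, mu; split => //; split => //; split.
- have oD : open (~` D) by apply: closed_openC; exact: closed_plan_domain.
  rewrite /concentrated_on; apply/eqP; rewrite eq_le measure_ge0 andbT.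
  apply: (le_trans (muU _ oD)); rewrite lee_fin.
  rewrite (@cvg_cst_eq _ F _ _ 0 PF _ (gl _ (open_borel oD)))// => n.
  by have [-> _ _] := ga n.
- move=> A mA; apply: (@plan_marginal_eq fst gamma F l) => //.
  + by move=> z; exact: cvg_fst.
  + by move=> n; have [] := ga n.
  + by move=> n B mB; have [_ + _] := ga n; exact.
- move=> A mA; apply: (@plan_marginal_eq snd gamma F l) => //.
  + by move=> z; exact: cvg_snd.
  + by move=> n; have [] := ga n.
  + by move=> n B mB; have [_ _ +] := ga n; exact.
Qed.

Section cost.
Variable phi : VV -> R.
Hypotheses (cphi : continuous phi) (phi0 : forall z, 0 <= phi z).

Local Notation J gamma := (\int[gamma]_(z in (D : set (borel VV))) (phi z)%:E)%E.

Lemma cost_bounded : exists B, forall z, D z -> phi z <= B.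
Proof.
have [->|/set0P[z0 Dz0]] := eqVneq D set0; first by exists 0.
have cD : compact D by exact: compact_setX.
have [z _ zmax] := compact_EVT_max (ex_intro _ z0 Dz0) cD (continuous_subspaceT cphi).
by exists (phi z) => w /mem_set/zmax.
Qed.

Lemma cost_measurable (S : set (borel VV)) : measurable S ->
  measurable_fun S (EFin \o phi : borel VV -> \bar R).
Proof. by move=> mS; apply/measurable_EFinP; exact: continuous_borel_measurable. Qed.

Lemma cost_ge0 gamma : (0 <= J gamma)%E.
Proof. by apply: integral_ge0 => z _; rewrite lee_fin. Qed.

Lemma cost_fin gamma : J gamma \is a fin_num.
Proof.
have mD := @measurable_plan_domain R d Omega.
rewrite ge0_fin_numE ?cost_ge0//.
have [B phiB] := cost_bounded.
apply: (@le_lt_trans _ _ (\int[gamma]_(z in (D : set (borel VV))) (cst B%:E) z)%E).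
  apply: ge0_le_integral => //.
  - by move=> z _; rewrite lee_fin.
  - exact: cost_measurable.
rewrite integral_cst//= ltey_eq fin_numM//.
by rewrite fin_num_measure.
Qed.

(** Otherwise rerouting the mass near [(x, y)] through [p] and [q] as in [admissible_split] lowers
    the cost by at least [eta * gamma U], which is positive because [(x, y)] is in the support. *)
Lemma no_improvement gamma x y p q : adm gamma ->
  (forall gamma', adm gamma' -> (J gamma <= J gamma')%E) ->
  spt gamma (x, y) -> boundary Omega p -> boundary Omega q ->
  phi (x, y) <= phi (x, p) + phi (q, y).
Proof.
move=> ag gmin gxy bp bq; rewrite leNgt; apply/negP => lt.
have [eta eta0 etaE] : exists2 eta : R, 0 < eta &
    eta < phi (x, y) - phi (x, p) - phi (q, y).
  by exists ((phi (x, y) - phi (x, p) - phi (q, y)) / 2); lra.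
have c1 : continuous (fun z : VV => phi (z.1, p)).
  by move=> z; apply: continuous_comp; [exact: send_fst_continuous|exact: cphi].
have c2 : continuous (fun z : VV => phi (q, z.2)).
  by move=> z; apply: continuous_comp; [exact: send_snd_continuous|exact: cphi].
(* A fixed gain eta on an open set avoids any measurable selection of exit
   points. *)
pose W := [set z : VV | eta < phi z - phi (z.1, p) - phi (q, z.2)].
have oW : open W.
  apply: (@open_superlevel R VV (fun z => phi z - phi (z.1, p) - phi (q, z.2))).
  by move=> z; apply: cvgB; [apply: cvgB; [exact: cphi|exact: c1]|exact: c2].
have mD := @measurable_plan_domain R d Omega.
have mW := open_borel oW.
pose U : set (borel VV) := W `&` D.
have mU : measurable (U : set (borel VV)) by exact: measurableI.
have Upos : (0 < gamma U)%E.
  by rewrite (measureI_conc mW mD); [exact: gxy|have [] := ag].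
have [g' [ag' g'E]] := admissible_split oO ag mU (@subIsetr _ _ _) bp bq.
have := gmin _ ag'; rewrite g'E//.
have mS (h : VV -> R) (S : set (borel VV)) : continuous h -> measurable S ->
    measurable_fun S (EFin \o h : borel VV -> \bar R).
  by move=> ch mS; apply/measurable_EFinP; exact: continuous_borel_measurable.
have mDU : measurable (D `\` U : set (borel VV)) by exact: measurableD.
have JE : (J gamma = \int[gamma]_(z in (D `\` U : set (borel VV))) (phi z)%:E +
    \int[gamma]_(z in (U : set (borel VV))) (phi z)%:E)%E.
  rewrite -ge0_integral_setU//.
  - by rewrite setDKU//; exact: subIsetr.
  - by apply: mS => //; exact: measurableU.
  - by move=> z _; rewrite lee_fin.
  - by apply/disj_set2P; rewrite setIC setDIK.
(* Finiteness of both pieces licenses the cancellations in the extended reals below. *)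
have fin1 := cost_fin gamma; rewrite JE fin_numD in fin1; move/andP: fin1 => [f1 f2].
have ge1 : ((\int[gamma]_(z in (U : set (borel VV))) (phi (z.1, p))%:E +
      \int[gamma]_(z in (U : set (borel VV))) (phi (q, z.2))%:E) + eta%:E * gamma U <=
    \int[gamma]_(z in (U : set (borel VV))) (phi z)%:E)%E.
  have m12 : measurable_fun U (fun z : borel VV => ((phi (z.1, p))%:E + (phi (q, z.2))%:E)%E).
    by apply: emeasurable_funD; exact: mS.
  rewrite -integral_cst// -ge0_integralD//; [|by move=> z _; rewrite lee_fin|exact: mS
    |by move=> z _; rewrite lee_fin|exact: mS].
  rewrite -ge0_integralD//; [|by move=> z _; rewrite -EFinD lee_fin addr_ge0
    |by move=> z _; rewrite lee_fin ltW].
  apply: ge0_le_integral => //.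
  - by move=> z _; rewrite -!EFinD lee_fin !addr_ge0// ltW.
  - by apply: emeasurable_funD => //; exact: measurable_cst.
  - exact: mS.
  - by move=> z [+ _]; rewrite /W /= -!EFinD lee_fin; lra.
rewrite JE leeD2lE// => le2.
have : (\int[gamma]_(z in (U : set (borel VV))) (phi z)%:E + eta%:E * gamma U <=
    \int[gamma]_(z in (U : set (borel VV))) (phi z)%:E)%E.
  by apply: le_trans ge1; apply: leeD.
rewrite -[leRHS]adde0 leeD2lE// leNgt mule_gt0// ?lte_fin//.
Qed.

Lemma spt_plan_domain gamma x y : adm gamma -> spt gamma (x, y) ->
  closure Omega x /\ closure Omega y.
Proof.
move=> [gD _ _] sxy; apply: contrapT => nD.
have := sxy (~` D) (closed_openC (@closed_plan_domain R d Omega)) nD.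
by rewrite gD ltxx.
Qed.

(** The exit and entry points of a segment leaving the closure would provide a detour that is
    strictly cheaper, against [no_improvement]. *)
Lemma minimizer_spt_segment gamma : adm gamma ->
  (forall gamma', adm gamma' -> (J gamma <= J gamma')%E) ->
  (forall x y p q, boundary Omega p -> boundary Omega q -> 0 < eucl_dist p q ->
    eucl_dist x p + eucl_dist p q + eucl_dist q y = eucl_dist x y ->
    phi (x, p) + phi (q, y) < phi (x, y)) ->
  forall x y, spt gamma (x, y) -> closed_segment x y `<=` closure Omega.
Proof.
move=> ag gmin strict x y sxy _ [t tI <-]; apply: contrapT => nt.
have [cx cy] := spt_plan_domain ag sxy.
have t01 : 0 <= t <= 1 by move: tI; rewrite /= in_itv.
have [p [q [bp bq pq pqE]]] := exit_points oO cx cy t01 nt.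
have := no_improvement ag gmin sxy bp bq.
by rewrite leNgt (strict _ _ _ _ bp bq pq pqE).
Qed.

(** The direct method: compactness along a minimizing sequence and lower semicontinuity of the cost.
    The mass bound is recorded because a limit of such minimizers is taken later. *)
Lemma minimizer_exists : boundary Omega !=set0 ->
  exists gamma, [/\ adm gamma, (gamma setT <= fp setT + fm setT)%E &
    forall gamma', adm gamma' -> (J gamma <= J gamma')%E].
Proof.
move=> [p bp]; have [g0 ag0] := admissible_exists oO bp fp0 fm0.
pose S := [set J gamma | gamma in adm].
have ME : (fp setT + fm setT = (fine (fp setT + fm setT))%:E)%E.
  by rewrite fineK// fin_numD !fin_num_measure.
have Sfin : ereal_inf S \is a fin_num.
  rewrite ge0_fin_numE; last by apply/ereal_infP => _ [g _ <-]; exact: cost_ge0.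
  apply: (@le_lt_trans _ _ (J g0)); first by apply: ereal_inf_lbound; exists g0.
  by rewrite ltey_eq cost_fin.
have /choice[g gP] (n : nat) : exists gamma, [/\ adm gamma, (gamma setT <= fp setT + fm setT)%E &
    (J gamma <= ereal_inf S + (n.+1%:R^-1)%:E)%E].
  have n0 : (0 : R) < n.+1%:R^-1 by rewrite invr_gt0.
  have [_ [g1 ag1 <-] g1le] := lb_ereal_inf_adherent n0 Sfin.
  (* The reduction gives the sequence a uniform mass bound without raising its cost. *)
  have [g2 [ag2 g2M g2le]] := admissible_reduce oO ag1.
  by exists g2; split => //; apply: le_trans (ltW g1le); exact: g2le.
have [||F [l [mu [[PF ooF] gl [amu muM] muU]]]] :=
  @admissible_limit (fine (fp setT + fm setT)) g.
- by move=> n; have [] := gP n.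
- by move=> n; rewrite -ME; have [] := gP n.
exists mu; split; [by []|by rewrite ME|].
move=> g' ag'; apply: (@le_trans _ _ (ereal_inf S)); last by apply: ereal_inf_lbound; exists g'.
apply/lee_addgt0Pr => e e0.
have [B phiB] := cost_bounded.
rewrite -(fineK Sfin) -EFinD.
apply: (@integral_lsc R VV (fine (fp setT + fm setT)) B _ g mu F l D phi PF gl) => //.
- by move=> n; rewrite -ME; have [] := gP n.
- exact: measurable_plan_domain.
- by move=> n; have [[]] := gP n.
apply: ooF; near=> n; have [_ _] := gP n; move=> /le_trans; apply.
rewrite EFinD fineK// leeD2l// lee_fin ltW//; near: n.
exact: near_infty_natSinv_lt (PosNum e0).
Unshelve. all: by end_near. Qed.

End cost.
End minimizers.

(** The suffixes [b] and [o] stand for the boundary part and the [Omega] part of an integral against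
    a marginal. Finiteness of each sum makes every term finite, which reduces the identity to one in
    [R]. *)
Lemma ereal_cancel (R : realType) (e xb xo yb yo : \bar R) :
  e \is a fin_num -> (xb + xo)%E \is a fin_num -> (yb + yo)%E \is a fin_num ->
  (e + yb - xb = e + (yb + yo) - (xb + xo) + (fine xo - fine yo)%:E)%E.
Proof.
move=> fe; rewrite !fin_numD => /andP[fxb fxo] /andP[fyb fyo].
rewrite -(fineK fe) -(fineK fxb) -(fineK fyb) -(fineK fxo) -(fineK fyo) /=.
by congr EFin; ring.
Qed.

(** * The objective as the integral of a continuous cost *)

Section plan_cost.
Import PairTopology.
Context (R : realType) (d : nat).
Local Notation V := 'rV[R]_d.
Local Notation VV := (V * V)%type.
Variables (Omega : set V).
Hypotheses (oO : open Omega) (cK : compact (closure Omega)).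
Implicit Types (gamma : {finite_measure set (borel VV) -> \bar R}) (p q x y : V).

Local Notation D := (closure Omega `*` closure Omega).

Lemma continuous_integrable gamma (h : VV -> R) (S : set (borel VV)) (B : R) :
  measurable S -> continuous h -> (forall z, S z -> `|h z| <= B) ->
  gamma.-integrable S (EFin \o h : borel VV -> \bar R).
Proof.
move=> mS ch hB; apply: measurable_bounded_integrable => //.
- by rewrite ltey_eq fin_num_measure.
- exact: continuous_borel_measurable.
- exists B; split; first exact: num_real.
  by move=> M /ltW BM z /hB; move/le_trans; apply.
Qed.

(** The closure is the disjoint union of [Omega], where the marginal is [nu], and the boundary,
    where [h] equals [g]. A change of variables along the projection [f] moves both integrals to the
    plan. *)
Lemma integral_marginal_boundary gamma (f : VV -> V) (h g : V -> R)
    (nu : {finite_measure set (borel V) -> \bar R}) :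
  continuous f -> (forall z, D z -> closure Omega (f z)) ->
  continuous h -> (forall x, boundary Omega x -> h x = g x) ->
  concentrated_on D gamma ->
  (forall A : set (borel V), measurable A -> gamma (f @^-1` (A `&` Omega)) = nu A) ->
  [/\ (\int[pushforward gamma (f : borel VV -> borel V)]_(y in
        (boundary Omega : set (borel V))) (g y)%:E
       + \int[nu]_(y in (Omega : set (borel V))) (h y)%:E
       = \int[gamma]_(z in (D : set (borel VV))) (h (f z))%:E)%E &
    gamma.-integrable (D : set (borel VV)) (EFin \o (h \o f) : borel VV -> \bar R)].
Proof.
move=> cf fD ch hg gD gnu.
have [B hB] : exists B, forall x, closure Omega x -> `|h x| <= B.
  have [->|/set0P cne] := eqVneq (closure Omega) set0; first by exists 0.
  have cnh : {within closure Omega, continuous (fun x => `|h x|)}.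
    apply: continuous_subspaceT => x.
    by apply: (@continuous_comp _ _ _ h (fun r => `|r|)); [exact: ch|exact: norm_continuous].
  have [x _ xmax] := compact_EVT_max cne cK cnh.
  by exists `|h x| => y /mem_set/xmax.
have chf : continuous (h \o f).
  by move=> z; apply: continuous_comp; [exact: cf|exact: ch].
have mf : measurable_fun setT (f : borel VV -> borel V).
  exact: continuous_map_borel_measurable.
have mh : measurable_fun setT (EFin \o h : borel V -> \bar R).
  by apply/measurable_EFinP; exact: continuous_borel_measurable.
have mpre (A : set (borel V)) : measurable A -> measurable (f @^-1` A : set (borel VV)).
  by move=> mA; rewrite -[X in measurable X]setTI; exact: (mf).
have mD := @measurable_plan_domain R d Omega.
have mO : measurable (Omega : set (borel V)) by exact: open_borel.
have mK : measurable (closure Omega : set (borel V)) by apply: closed_borel; exact: closed_closure.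
have mB : measurable (boundary Omega : set (borel V)).
  by rewrite (open_boundaryE oO); exact: measurableD.
have BK : boundary Omega `<=` closure Omega by move=> x [].
have OK : Omega `<=` closure Omega by exact: subset_closure.
have intS (A : set (borel V)) : measurable A -> A `<=` closure Omega ->
    gamma.-integrable (f @^-1` A) (EFin \o (h \o f) : borel VV -> \bar R).
  move=> mA AK; apply: (@continuous_integrable _ _ _ B) => //; first exact: mpre.
  by move=> z /AK; exact: hB.
split; last by apply: (@continuous_integrable _ _ _ B) => // z /fD; exact: hB.
(* On the boundary [g] is replaced by the continuous [h], to which the change of variables
   applies. *)
have -> : (\int[pushforward gamma (f : borel VV -> borel V)]_(y in
      (boundary Omega : set (borel V))) (g y)%:E =
    \int[gamma]_(z in (f @^-1` boundary Omega : set (borel VV))) ((EFin \o h) \o f) z)%E.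
  rewrite -(integral_pushforward mf mh (intS _ mB BK) mB).
  apply: eq_integral; first exact: (mf).
  by move=> x; rewrite inE => bx; rewrite /= hg.
rewrite [X in (_ + X)%E](_ : _ =
    \int[gamma]_(z in (f @^-1` Omega : set (borel VV))) ((EFin \o h) \o f) z)%E; last first.
  rewrite -(integral_pushforward mf mh (intS _ mO OK) mO).
  have [pi [piE _]] := finite_pushforward gamma mf.
  have -> : pushforward gamma (f : borel VV -> borel V) = pi by apply/funext => A; rewrite piE.
  apply: eq_measure_integral => A mA AO; have := gnu A mA.
  by rewrite (setIidl AO) -piE => /esym.
rewrite -integral_setU; last 4 first.
- exact: mpre.
- exact: mpre.
- apply/measurable_EFinP; apply: (@continuous_borel_measurable R VV _ (h \o f)) => //.
  by apply: measurableU; exact: mpre.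
- apply/disj_set2P; apply/seteqP; split => // z [/=].
  by rewrite open_boundaryE// => -[].
rewrite -preimage_setU setUC -(closure_setUboundary oO).
(* The preimage of the closure may be larger than [D], but the excess is null for [gamma]. *)
rewrite (negligible_integral (measurableC mD) (mpre _ mK) (intS _ mK (@subset_refl _ _)) gD).
rewrite setDE setCK; congr (integral _ _ _).
by apply/setIidPr => z /fD.
Qed.

Definition plan_cost (h : V -> R) (z : VV) : R := eucl_dist z.1 z.2 + h z.2 - h z.1.

Lemma plan_cost_continuous h : continuous h -> continuous (plan_cost h).
Proof.
move=> ch z; apply: cvgB; first apply: cvgD.
- exact: eucl_dist_continuous.
- by apply: (@continuous_comp _ _ _ snd h); [exact: cvg_snd|exact: ch].
- by apply: (@continuous_comp _ _ _ fst h); [exact: cvg_fst|exact: ch].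
Qed.

Lemma plan_cost_ge0 h : eucl_lipschitz_on setT 1 h -> forall z, 0 <= plan_cost h z.
Proof.
move=> hl z; have := hl z.1 z.2 I I; rewrite mul1r => /ler_normlP[_].
rewrite /plan_cost; lra.
Qed.

(** Passing from the boundary to the whole closure adds the integrals of [h] over [Omega], and these
    are fixed by the prescribed marginals: the constant is the integral of [h] against [fp] minus
    that against [fm]. *)
Lemma KPb_costE (fp fm : {finite_measure set (borel V) -> \bar R}) (g h : V -> R) :
  continuous h -> (forall x, boundary Omega x -> h x = g x) ->
  exists C : R, forall gamma, admissible Omega fp fm gamma ->
    (KPb_cost Omega g gamma =
     \int[gamma]_(z in (D : set (borel VV))) (plan_cost h z)%:E + C%:E)%E.
Proof.
move=> ch hg.
pose cy := fine (\int[fm]_(y in (Omega : set (borel V))) (h y)%:E)%E.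
pose cx := fine (\int[fp]_(y in (Omega : set (borel V))) (h y)%:E)%E.
exists (cx - cy) => gamma [gD gx gy].
have mD := @measurable_plan_domain R d Omega.
have [Ey iy] := @integral_marginal_boundary gamma snd h g fm (fun z => @cvg_snd _ _ _ _ _)
   (fun z (Dz : D z) => Dz.2) ch hg gD gy.
have [Ex ix] := @integral_marginal_boundary gamma fst h g fp (fun z => @cvg_fst _ _ _ _ _)
   (fun z (Dz : D z) => Dz.1) ch hg gD gx.
have [B eB] := @cost_bounded R d Omega cK (fun z => eucl_dist z.1 z.2) (@eucl_dist_continuous R d).
have ie : gamma.-integrable (D : set (borel VV))
    (EFin \o (fun z => eucl_dist z.1 z.2) : borel VV -> \bar R).
  apply: (@continuous_integrable _ _ _ B) => //; first exact: eucl_dist_continuous.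
  by move=> z Dz; rewrite ger0_norm ?eucl_dist_ge0//; exact: eB.
have fy := integrable_fin_num mD iy.
have fx := integrable_fin_num mD ix.
have fe := integrable_fin_num mD ie.
rewrite /KPb_cost.
have -> : (\int[gamma]_(z in (D : set (borel VV))) (plan_cost h z)%:E =
   \int[gamma]_(z in (D : set (borel VV))) (eucl_dist z.1 z.2)%:E +
   \int[gamma]_(z in (D : set (borel VV))) (h z.2)%:E -
   \int[gamma]_(z in (D : set (borel VV))) (h z.1)%:E)%E.
  rewrite -integralD//= -integralB//=.
  by apply: integrableD.
move: fx fy; rewrite /marginal_x /marginal_y.
have -> : (\int[gamma]_(z in (D : set (borel VV))) (EFin \o (h \o fst)) z =
  \int[gamma]_(z in (D : set (borel VV))) (h z.1)%:E)%E by [].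
have -> : (\int[gamma]_(z in (D : set (borel VV))) (EFin \o (h \o snd)) z =
  \int[gamma]_(z in (D : set (borel VV))) (h z.2)%:E)%E by [].
rewrite -Ex -Ey => fx fy.
exact: ereal_cancel.
Qed.

End plan_cost.

(** * Minimizers of the boundary problem and their segments *)

Section problem.
Import PairTopology.
Context (R : realType) (d : nat).
Local Notation V := 'rV[R]_d.
Local Notation VV := (V * V)%type.
Variables (Omega : set V) (fp fm : {finite_measure set (borel V) -> \bar R}).
Hypotheses (oO : open Omega) (cK : compact (closure Omega)).
Hypothesis (bO : boundary Omega !=set0).
Hypotheses (fp0 : concentrated_on Omega fp) (fm0 : concentrated_on Omega fm).
Implicit Types (gamma : {finite_measure set (borel VV) -> \bar R}) (p q x y : V).

Local Notation D := (closure Omega `*` closure Omega).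
Local Notation adm := (admissible Omega fp fm).
Local Notation J phi gamma := (\int[gamma]_(z in (D : set (borel VV))) (phi z)%:E)%E.

Lemma KPb_minimizerP (g h : V -> R) gamma :
  eucl_lipschitz_on setT 1 h -> (forall x, boundary Omega x -> h x = g x) ->
  KPb_minimizer Omega fp fm g gamma <->
  adm gamma /\ forall gamma', adm gamma' ->
    (J (plan_cost h) gamma <= J (plan_cost h) gamma')%E.
Proof.
move=> hl hg; have ch := eucl_lipschitz_continuous hl.
have [C CE] := KPb_costE oO cK fp fm ch hg.
split=> -[ag gmin]; split => // g' ag'; have := gmin g' ag'.
  by rewrite !CE// leeD2rE.
by rewrite !CE// leeD2rE.
Qed.

Lemma segment_avoiding_open (t : R) :
  open [set z : VV | ~ closure Omega (seg z.1 z.2 t)].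
Proof.
have cs : continuous (fun z : VV => seg z.1 z.2 t).
  move=> z; apply: (@cvgD _ _ _ (nbhs z)).
    by apply: (@cvgZl_tmp _ _ _ (nbhs z)); exact: cvg_fst.
  by apply: (@cvgZl_tmp _ _ _ (nbhs z)); exact: cvg_snd.
rewrite (_ : [set z | _] = (fun z : VV => seg z.1 z.2 t) @^-1` (~` closure Omega))//.
apply: open_comp; first by move=> z _; exact: cs.
exact: closed_openC (@closed_closure _ Omega).
Qed.

(** If the segment of [(x, y)] leaves the closure at parameter [t], so do the segments of all nearby
    pairs at the same [t]. A neighbourhood of [(x, y)] is then null for every [gamma n], hence for
    [l] and for [mu]. *)
Lemma limit_spt_segment (gamma : nat -> {finite_measure set (borel VV) -> \bar R})
    (F : set_system nat) (l : set (borel VV) -> R)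
    (mu : {finite_measure set (borel VV) -> \bar R}) :
  ProperFilter F ->
  (forall A, measurable A -> fine (gamma n A) @[n --> F] --> l A) ->
  (forall U : set VV, open U -> (mu U <= (l U)%:E)%E) ->
  (forall n, concentrated_on D (gamma n)) ->
  (forall n x y, spt (gamma n) (x, y) -> closed_segment x y `<=` closure Omega) ->
  forall x y, spt mu (x, y) -> closed_segment x y `<=` closure Omega.
Proof.
move=> PF gl muU gD gs x y sxy _ [t tI <-]; apply: contrapT => nt.
pose O := [set z : VV | ~ closure Omega (seg z.1 z.2 t)].
have nO : set_nbhs [set (x, y)] O.
  by apply/set_nbhsP; exists O; split=> [||//]; [exact: segment_avoiding_open|move=> _ ->].
(* Shrinking to [W] with closure in [O] makes [D & closure W] a compact set missing the support of
   each [gamma n], as [null_off_spt] requires. *)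
have [W /set_nbhsP[W' [oW' xyW' W'W]] WO] : filter_from (set_nbhs [set (x, y)]) closure O.
  apply: (@pseudometric_normal R VV) => //.
  apply: compact_closed; last exact: compact_set1.
  exact: hausdorff_plan.
have := sxy W' oW' (xyW' _ erefl); rewrite ltNge => /negP; apply.
apply: (le_trans (muU _ oW')); rewrite lee_fin.
rewrite (@cvg_cst_eq _ F _ _ 0 PF _ (gl _ (open_borel oW')))// => n.
have mD := @measurable_plan_domain R d Omega.
rewrite -(measureI_conc (open_borel oW') mD (gD n)).
have cC : compact (D `&` closure W).
  by apply: compact_closedI; [exact: compact_setX|exact: closed_closure].
have C0 : gamma n (D `&` closure W) = 0%E.
  apply: (null_off_spt cC); last exact: hausdorff_plan.
  move=> [u v] [_ /WO/= nuv] suv; apply: nuv; apply: (gs n u v suv).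
  by exists t.
have mC : measurable (D `&` closure W : set (borel VV)).
  by apply: closed_borel; apply: compact_closed => //; exact: hausdorff_plan.
suff /(congr1 fine) : gamma n (W' `&` D) = 0%E by [].
apply: (subset_measure0 _ mC _ C0).
  by apply: measurableI => //; exact: open_borel.
by move=> z [/W'W/subset_closure ? ?]; split.
Qed.

(** The detour through [p] and [q] changes the cost by [g p - g q - |p - q|], at most
    [(lambda - 1) |p - q|], which is negative. *)
Lemma KPb_lambda_spt (g h : V -> R) (lambda : R) gamma :
  eucl_lipschitz_on setT 1 h -> (forall x, boundary Omega x -> h x = g x) ->
  lambda < 1 -> eucl_lipschitz_on (boundary Omega) lambda g ->
  KPb_minimizer Omega fp fm g gamma ->
  forall x y, spt gamma (x, y) -> closed_segment x y `<=` closure Omega.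
Proof.
move=> hl hg l1 gl /(KPb_minimizerP _ hl hg)[ag gmin].
have ch := eucl_lipschitz_continuous hl.
apply: (minimizer_spt_segment oO cK (plan_cost_continuous ch) (plan_cost_ge0 hl) ag gmin).
move=> x y p q bp bq pq pqE; rewrite /plan_cost /= (hg p bp) (hg q bq).
have := gl p q bp bq; move=> /ler_normlP[_].
have : lambda * eucl_dist p q < eucl_dist p q by rewrite gtr_pMl.
lra.
Qed.

Lemma KPb_minimizer_exists (g h : V -> R) :
  eucl_lipschitz_on setT 1 h -> (forall x, boundary Omega x -> h x = g x) ->
  exists gamma, KPb_minimizer Omega fp fm g gamma /\
    forall x y, spt gamma (x, y) -> closed_segment x y `<=` closure Omega.
Proof.
move=> hl hg.
have ch := eucl_lipschitz_continuous hl.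
have c0 := plan_cost_ge0 hl; have cc := plan_cost_continuous ch.
pose e (z : VV) := eucl_dist z.1 z.2.
have ce : continuous e by exact: eucl_dist_continuous.
have e0 z : 0 <= e z by exact: eucl_dist_ge0.
pose phi (n : nat) (z : VV) := plan_cost h z + n.+1%:R^-1 * e z.
have r0 (n : nat) : (0 : R) < n.+1%:R^-1 by rewrite invr_gt0.
have cphi n : continuous (phi n).
  by move=> z; apply: cvgD; [exact: cc|apply: cvgMl_tmp; exact: ce].
have phi0 n z : 0 <= phi n z by rewrite addr_ge0// mulr_ge0// ltW.
have /choice[gamma gP] (n : nat) : exists gamma, [/\ adm gamma,
    (gamma setT <= fp setT + fm setT)%E &
    forall gamma', adm gamma' -> (J (phi n) gamma <= J (phi n) gamma')%E].
  exact: (minimizer_exists oO cK fp0 fm0 (cphi n) (phi0 n) bO).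
have gs n x y : spt (gamma n) (x, y) -> closed_segment x y `<=` closure Omega.
  have [ag _ gmin] := gP n.
  apply: (minimizer_spt_segment oO cK (cphi n) (phi0 n) ag gmin).
  move=> {}x {}y p q bp bq pq pqE.
  have hpq : h p - h q <= eucl_dist p q.
    by have := hl p q I I; rewrite mul1r => /ler_normlP[].
  (* The detour does not raise [plan_cost h], while the added term drops strictly, by [|p - q|]
     times its coefficient. *)
  have dlt : eucl_dist x p + eucl_dist q y < eucl_dist x y by lra.
  rewrite -(ltr_pM2l (r0 n)) mulrDr in dlt.
  by rewrite /phi /plan_cost /e /=; move: dlt; set r := _^-1; lra.
pose M := fine (fp setT + fm setT)%E.
have ME : (fp setT + fm setT = M%:E)%E.
  by rewrite fineK// fin_numD !fin_num_measure.
have gM n : (gamma n setT <= M%:E)%E by rewrite -ME; have [] := gP n.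
have ga n : adm (gamma n) by have [] := gP n.
have gD n : concentrated_on D (gamma n) by have [] := ga n.
have [F [l [mu [[PF ooF] gl [amu muM] muU]]]] := admissible_limit oO cK fp0 fm0 ga gM.
exists mu; split; last exact: (limit_spt_segment PF gl muU gD gs).
apply/(KPb_minimizerP _ hl hg); split => // g' ag'.
have mD := @measurable_plan_domain R d Omega.
have fJ (phi' : VV -> R) : continuous phi' -> (forall z, 0 <= phi' z) -> J phi' g' \is a fin_num.
  by move=> cphi' phi'0; exact: cost_fin.
have [B cB] := cost_bounded cK cc.
have phiJ n : (J (phi n) g' = J (plan_cost h) g' + (n.+1%:R^-1)%:E * J e g')%E.
  rewrite -ge0_integralZl_EFin//; last 2 first.
  - by move=> z _; rewrite lee_fin.
  - exact: cost_measurable.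
  rewrite -ge0_integralD//.
  - by move=> z _; rewrite lee_fin.
  - exact: cost_measurable.
  - by move=> z _; rewrite mule_ge0// lee_fin// ltW.
  - by apply: measurable_funeM; exact: cost_measurable.
apply/lee_addgt0Pr => eps eps0.
have Je0 : 0 <= fine (J e g') by rewrite fine_ge0// cost_ge0.
(* Once [1 / (n + 1)] is below this threshold, the perturbation costs [g'] at most [eps]; the [+ 1]
   keeps the denominator positive. *)
have p0 : 0 < eps / (fine (J e g') + 1) by rewrite divr_gt0// ltr_wpDl.
rewrite -(fineK (fJ _ cc c0)) -EFinD.
apply: (@integral_lsc R VV M B _ gamma mu F l D (plan_cost h) PF gl) => //.
apply: ooF; near=> n.
have [_ _ gmin] := gP n.
(* The chain is: unperturbed cost of [gamma n], perturbed cost of [gamma n], perturbed cost of [g'],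
   unperturbed cost of [g'] plus [eps]. *)
apply: (@le_trans _ _ (J (phi n) (gamma n))).
  apply: ge0_le_integral => //.
  - by move=> z _; rewrite lee_fin.
  - exact: cost_measurable.
  - exact: cost_measurable.
  - by move=> z _; rewrite lee_fin /phi lerDl mulr_ge0// ltW.
apply: (le_trans (gmin _ ag')); rewrite phiJ EFinD fineK ?fJ// leeD2l//.
rewrite -(fineK (fJ _ ce e0)) -EFinM lee_fin.
have nle : n.+1%:R^-1 <= eps / (fine (J e g') + 1).
  by rewrite ltW//; near: n; exact: near_infty_natSinv_lt (PosNum p0).
apply: (le_trans (ler_wpM2r Je0 nle)).
by rewrite mulrAC ler_pdivrMr ?ltr_wpDl// ler_pM2l// lerDl.
Unshelve. all: by end_near. Qed.

End problem.

Theorem proposition2p4 (R : realType) (d : nat) (d_gt0 : (0 < d)%N)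
    (Omega : set 'rV[R]_d)
    (Omega_open : open Omega) (Omega_connected : connected Omega)
    (Omega_nonempty : Omega !=set0) (Omega_bounded : bounded_set Omega)
    (fp fm : {finite_measure set (borel 'rV[R]_d) -> \bar R})
    (fp_Omega : concentrated_on Omega fp) (fm_Omega : concentrated_on Omega fm)
    (g1 g2 : 'rV[R]_d -> R)
    (g12 : forall x y : 'rV[R]_d, boundary Omega x -> boundary Omega y ->
       `|g1 x - g2 y| <= eucl_dist x y) :
  (forall x : 'rV[R]_d, boundary Omega x -> g1 x = g2 x) /\
  let g := g1 in
  [/\ eucl_lipschitz_on (boundary Omega) 1 g,
      exists gamma : {finite_measure set (borel ('rV[R]_d * 'rV[R]_d)) -> \bar R},
        KPb_minimizer Omega fp fm g gamma /\
        forall x y : 'rV[R]_d, spt gamma (x, y) -> closed_segment x y `<=` closure Omega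
    & forall lambda : R, lambda < 1 ->
        eucl_lipschitz_on (boundary Omega) lambda g ->
        forall gamma : {finite_measure set (borel ('rV[R]_d * 'rV[R]_d)) -> \bar R},
          KPb_minimizer Omega fp fm g gamma ->
          forall x y : 'rV[R]_d, spt gamma (x, y) -> closed_segment x y `<=` closure Omega].
Proof.
have gE x : boundary Omega x -> g1 x = g2 x.
  (* The joint bound is used on the diagonal, where the distance vanishes. *)
  move=> bx; apply/eqP; rewrite -subr_eq0 -normr_le0.
  by rewrite -(eucl_distxx x); exact: g12.
have gl : eucl_lipschitz_on (boundary Omega) 1 g1.
  by move=> x y bx by_; rewrite mul1r (gE y by_); exact: g12.
have cK := compact_closure_bounded Omega_bounded.
have bO := boundary_nonempty d_gt0 Omega_open Omega_nonempty Omega_bounded.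
have [h [hl hg]] := mcshane_extension gl.
split=> [//|g]; split => //.
  exact: (KPb_minimizer_exists Omega_open cK bO fp_Omega fm_Omega hl hg).
move=> lambda l1 ll gamma gmin.
exact: (KPb_lambda_spt Omega_open cK hl hg l1 ll gmin).
Qed.
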